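(* Let $k$ be an algebraically closed field of positive characteristic, and let $\mathfrak m=(X_1,\dots,X_N)$ be the maximal ideal defining the origin $0\in\mathbb{A}_k^N$. Then, for a positive integer $\mu$, there is a positive integer $L_{N,\mu}$ depending only on $N$ and $\mu$ such that for every $\mathfrak m$-primary ideal $\mathfrak a$ such that $\mathfrak m^\mu\subset\mathfrak a$ and $(\mathbb{A}_k^N,\mathfrak a)\in\mathcal L_k$, there is some prime divisor $E$ over $\mathbb{A}_k^N$ that computes $\mathrm{lct}(0;\mathbb{A}_k^N,\mathfrak a)$ and satisfies $k_E\le L_{N,\mu}$.
   Context: Let $A=\mathbb{A}_k^N=\operatorname{Spec}k[X_1,\dots,X_N]$, $N\ge 1$. A prime divisor $E$ over $A$ is a prime divisor on some normal $A'$ with a birational morphism $A'\to A$; $\mathrm{val}_E$ is the corresponding valuation and $k_E$ is the coefficient at $E$ of the relative canonical divisor $K_{A'/A}$. For a nonzero ideal $\mathfrak a$ of $k[X_1,\dots,X_N]$, the log canonical threshold at the origin is $$\mathrm{lct}(0;A,\mathfrak a)=\sup\{r\in\mathbb{R}_{\ge0}\mid (A,\mathfrak a^r)\text{ is log canonical at }0\}=\inf_E\frac{k_E+1}{\mathrm{val}_E(\mathfrak a)},$$ where $E$ runs over prime divisors over $A$ whose center contains $0$. Such an $E$ computes $\mathrm{lct}(0;A,\mathfrak a)$ if $\frac{k_E+1}{\mathrm{val}_E(\mathfrak a)}=\mathrm{lct}(0;A,\mathfrak a)$. A prime divisor $E$ over $\mathbb{A}_k^N$ is a toric prime divisor if there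 is $w\in\mathbb{Z}_{\ge0}^N$ such that $\mathrm{val}_E(f)=\min\{\sum_i w_iu_i\mid X^u \text{ appears in } f \text{ with nonzero coefficient}\}$ for all polynomials $f$. We say $\mathrm{lct}(0;\mathbb{A}_k^N,\mathfrak a)$ has a toric approximation if for every $\epsilon>0$ there is a toric prime divisor $E_\epsilon$ over $\mathbb{A}_k^N$ with $\left|\frac{k_{E_\epsilon}+1}{\mathrm{val}_{E_\epsilon}\mathfrak a}-\mathrm{lct}(0;\mathbb{A}_k^N,\mathfrak a)\right|<\epsilon$. $\mathcal L_k$ is the set of pairs $(\mathbb{A}_k^N,\mathfrak a)$, $N\ge1$, such that $\mathrm{lct}(0;\mathbb{A}_k^N,\mathfrak a)$ has a toric approximation. *)

(* Defs.v *)
From HB Require Import structures.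
From mathcomp Require Import all_boot all_order all_algebra.
From mathcomp Require Import boolp classical_sets reals ereal.
From mathcomp Require Import fraction ring.
(* The notations of mpoly clash with those of classical_sets. *)
From mathcomp Require mpoly.
Import -(notations) mpoly.

Set Implicit Arguments.
Unset Strict Implicit.
Unset Printing Implicit Defensive.

Import Order.TTheory GRing.Theory Num.Theory.
Local Open Scope classical_set_scope.
Local Open Scope ring_scope.

Notation polyRing k N := (mpoly N k).
Notation polyX k i := (@mpolyX _ k (mnm1 i)).
Notation funField k N := {fraction (polyRing k N)}.

Section Ideals.
Variable R : comNzRingType.
Implicit Types B I J S : set R.

(* Ideals of a subring B of R; ideals of R itself are the case B = setT. *)
Definition is_ideal B I :=
  [/\ I `<=` B, I 0, forall x y, I x -> I y -> I (x + y)
    & forall b x, B b -> I x -> I (b * x)].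

Definition is_prime_ideal B I :=
  [/\ is_ideal B I, ~ I 1
    & forall x y, B x -> B y -> I (x * y) -> I x \/ I y].

(* For a domain B. *)
Definition is_height_one_prime B I :=
  [/\ is_prime_ideal B I, I <> [set 0]
    & forall J, is_prime_ideal B J -> J `<=` I -> J = [set 0] \/ J = I].

Definition ideal_gen S : set R :=
  [set x | forall I, is_ideal setT I -> S `<=` I -> I x].

Definition ideal_pow I n : set R :=
  ideal_gen
    [set x | exists2 f : 'I_n -> R, (forall i, I (f i)) & x = \prod_i f i].

Definition radical I : set R := [set x | exists n, I (x ^+ n)].

Definition is_primary_ideal I :=
  [/\ is_ideal setT I, ~ I 1
    & forall x y, I (x * y) -> I x \/ radical I y].

Definition primary_to M I := is_primary_ideal I /\ radical I = M.

Definition integrally_closed_in B :=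
  forall x (q : {poly R}),
    q \is monic -> (forall i, B q`_i) -> root q x -> B x.

End Ideals.

Definition localization (K : fieldType) (B P : set K) : set K :=
  [set x | exists a s, [/\ B a, B s, ~ P s & x = a / s]].

(* v is the normalized discrete valuation of K with valuation ring O; the value
   v 0, which should be +oo, is left unspecified and never used. *)
Definition is_valuation_of (K : fieldType) (O : set K) (v : K -> int) :=
  [/\ forall x y, x != 0 -> y != 0 -> v (x * y) = v x + v y,
      forall x y, x != 0 -> y != 0 -> x + y != 0 ->
        Order.min (v x) (v y) <= v (x + y),
      exists2 t, t != 0 & v t = 1
    & forall x, x != 0 -> O x <-> 0 <= v x].

Section AffineSpace.
Variables (k : fieldType) (N : nat).
Local Notation A := (polyRing k N).
Local Notation K := (funField k N).

Definition origin_ideal : set A :=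
  ideal_gen [set f | exists i : 'I_N, f = polyX k i].

(* The k-subalgebra of K generated by g. *)
Definition subalgebra_gen n (g : 'I_n -> K) : set K :=
  [set x | exists P : polyRing k n,
     x = mmap (fun c => tofrac (mpolyC N c)) g P].

(* A prime divisor E on a normal variety A' with a birational morphism A' -> A,
   given on an affine open Spec B of A' meeting E.  The morphism identifies the
   function field of A' with K, so B is a finitely generated normal k-algebra
   with k[X] <= B <= K, and E is a height one prime of B.  Conversely every such
   Spec B -> A is a birational morphism from a normal variety.  The local ring
   of A' at E is a discrete valuation ring, so that the field div_val exists and
   is unique on K^*. *)
Record prime_divisor := PrimeDivisor {
  div_chart : set K;
  div_ideal : set K;
  div_val : K -> int;
  div_chart_fg : exists n (g : 'I_n -> K), div_chart = subalgebra_gen g;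
  div_chart_poly : forall f : A, div_chart (tofrac f);
  div_chart_normal : integrally_closed_in div_chart;
  div_ideal_height1 : is_height_one_prime div_chart div_ideal;
  div_valP : is_valuation_of (localization div_chart div_ideal) div_val }.

Definition local_ring (E : prime_divisor) : set K :=
  localization (div_chart E) (div_ideal E).

Definition center_contains_origin (E : prime_divisor) :=
  forall f : A, div_ideal E (tofrac f) -> origin_ideal f.

(* The extension of d/dX_i to K by the quotient rule. *)
Definition fderiv (i : 'I_N) (x : K) : K :=
  let n := \n_(repr x) in let d := \d_(repr x) in
  tofrac (mderiv i n * d - n * mderiv i d) / tofrac (d ^+ 2).

Definition jacobian (y : 'I_N -> K) : 'M[K]_N :=
  \matrix_(i, j) fderiv j (y i).

(* The differentials dX_j form a basis of Omega_{K/k}, in which df has the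
   coordinates fderiv j f.  The condition says that the dy_i form a basis of
   Omega_{O/k}, inside Omega_{K/k}, for the local ring O at E. *)
Definition is_differential_basis (E : prime_divisor) (y : 'I_N -> K) :=
  (forall i, local_ring E (y i)) /\
  (forall f, local_ring E f ->
     exists2 c : 'I_N -> K, (forall i, local_ring E (c i))
       & forall j, fderiv j f = \sum_i c i * fderiv j (y i)).

(* k_E is the order along E of the pull-back of dX_1 /\ ... /\ dX_N with respect
   to a local generator dy_1 /\ ... /\ dy_N of the canonical sheaf of A', where
   dy_1 /\ ... /\ dy_N = det (dy_i/dX_j) dX_1 /\ ... /\ dX_N. *)
Definition is_discrepancy (E : prime_divisor) (n : int) :=
  exists2 y, is_differential_basis E y
    & n = - div_val E (\det (jacobian y)).

Definition discrepancy (E : prime_divisor) : int :=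
  xget 0 [set n | is_discrepancy E n].

(* val_E(a) for a nonzero ideal a. *)
Definition ideal_val (E : prime_divisor) (a : set A) : int :=
  xget 0 [set n |
    (exists f, [/\ a f, f != 0 & div_val E (tofrac f) = n]) /\
    (forall f, a f -> f != 0 -> n <= div_val E (tofrac f))].

Definition is_toric (E : prime_divisor) :=
  exists w : 'I_N -> nat, forall f : A, f != 0 ->
    let weight (u : multinom N) :=
      (\sum_(i < N) w i * u i)%N in
    (exists2 u, u \in msupp f & div_val E (tofrac f) = (weight u)%:Z) /\
    (forall u, u \in msupp f -> div_val E (tofrac f) <= (weight u)%:Z).

Section Lct.
Variable R : realType.
Local Open Scope ereal_scope.

(* (k_E + 1) / val_E(a), which is +oo when val_E(a) = 0. *)
Definition lct_ratio (E : prime_divisor) (a : set A) : \bar R :=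
  if ideal_val E a == 0%R then +oo
  else (((discrepancy E + 1)%:~R / (ideal_val E a)%:~R)%R)%:E.

Definition lct (a : set A) : \bar R :=
  ereal_inf [set lct_ratio E a | E in center_contains_origin].

Definition computes_lct (E : prime_divisor) (a : set A) :=
  center_contains_origin E /\ lct_ratio E a = lct a.

Definition has_toric_approximation (a : set A) :=
  forall e : R, (0 < e)%R ->
    exists2 E : prime_divisor, is_toric E
      & `|lct_ratio E a - lct a| < e%:E.

End Lct.

End AffineSpace.

Arguments origin_ideal k N : clear implicits.

Lemma tofrac_repr (D : idomainType) (x : {fraction D}) :
  tofrac \n_(repr x) / tofrac \d_(repr x) = x.
Proof.
have d0 : \d_(repr x) != 0 by exact: denom_ratioP.
rewrite -{3}[x]reprK; apply/(mulIf (x := tofrac \d_(repr x))).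
  by rewrite tofrac_eq0.
rewrite mulfVK ?tofrac_eq0 //; move: (repr x) d0 => r d0.
unlock tofrac.
rewrite !piE; apply/eqP; rewrite piE /FracField.mulf.
rewrite /FracField.equivf /= !numden_Ratio ?oner_eq0 ?mulf_neq0 ?oner_eq0 //.
by rewrite !mulr1 mul1r mulrC.
Qed.

Lemma fderiv_frac (k : fieldType) (N : nat) (i : 'I_N) (a b : polyRing k N) :
  b != 0 ->
  fderiv i (tofrac a / tofrac b) =
    tofrac (mderiv i a * b - a * mderiv i b) / tofrac (b ^+ 2).
Proof.
move=> b0; rewrite /fderiv; have := tofrac_repr (tofrac a / tofrac b).
have := denom_ratioP (repr (tofrac a / tofrac b)).
move: \n_(repr _) \d_(repr _) => n d d0 xE.
have e : n * b = a * d.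
  by apply/eqP; rewrite -tofrac_eq !tofracM -eqr_div ?tofrac_eq0 // xE.
have e' := congr1 (mderiv i) e; rewrite !mderivM in e'.
apply/eqP; rewrite eqr_div ?tofrac_eq0 ?expf_neq0 // -!tofracM tofrac_eq.
apply/eqP.
move: (mderiv i n) (mderiv i d) (mderiv i a) (mderiv i b) e' => n' d' a' b' e'.
have -> : (n' * d - n * d') * b ^+ 2 =
    (n' * b + n * b') * (d * b) - n * b * (b' * d) - n * b * (d' * b) by ring.
by rewrite e' e; ring.
Qed.

(* Main.v *)
(** A toric divisor of weight [w] has discrepancy [|w| - 1], and its value on
    [a] is the minimum of [w.u] over the exponents [u] occurring in elements of
    [a].  As [m ^ mu <= a], exponents of degree at most [mu] suffice, so only
    finitely many sets of exponents matter for given [N] and [mu].  For each of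
    them the ratio [|w| / min w.u] attains its minimum at some primitive
    integral weight (Dickson's lemma).  The toric divisor of that weight has
    the least ratio among all toric divisors; by the toric approximation this
    ratio is the log canonical threshold.  The bound on the discrepancy is the
    maximum of [|w| - 1] over the finitely many optimal weights. *)

Require Import Defs.
From mathcomp Require Import all_boot all_order all_algebra.
From mathcomp Require Import boolp classical_sets reals ereal.
From mathcomp Require Import perm fraction ring zify.
From mathcomp Require mpoly.
Import -(notations) mpoly.

Set Implicit Arguments.
Unset Strict Implicit.
Unset Printing Implicit Defensive.

Import Order.TTheory GRing.Theory Num.Theory.
Local Open Scope classical_set_scope.
Local Open Scope ring_scope.

(** * Optimal weights *)

(** The bound has to be fixed before the field is known, whereas the exponents occurring in an ideal
    depend on it. The optimisation is therefore purely combinatorial: it is solved for every set of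
    exponents of degree at most [mu], in terms of pairs (w, t) with t <= w.u on the set, and a field
    and an ideal only select one of these sets. Two points need geometry. The optimal weight must
    come from a divisor in the given sense, so a toric chart has to be shown finitely generated and
    normal. Normality rests on polynomial rings being completely integrally closed, a property that
    passes to one more variable through leading coefficients. Moreover the value |w| - 1 has to come
    from differentials in every characteristic, where weights may vanish in [k]; a unimodular change
    of exponents avoids dividing by them. The divisors supplied by the approximation may have any
    chart, but the discrepancy is determined by the valuation, and normalisation forces their
    weights to be primitive, so the same formula covers them. *)

Section Weights.
Local Open Scope nat_scope.

(** Induction on the coordinates. Let [M] be the largest value of the new coordinate on a dominating
    list for the old ones. Points with value at least [M] are dominated by that list, and each of
    the finitely many slices with a smaller value has its own list. *)
Lemma dickson (I T : eqType) (f : I -> T -> nat) (D : seq I) (P : T -> Prop) :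
  exists B : seq T, (forall b, b \in B -> P b) /\
    forall p, P p -> exists2 b, b \in B & forall i, i \in D -> f i b <= f i p.
Proof.
elim: D P => [|i D IH] P.
  have [[p Pp]|nP] := pselect (exists p, P p); last first.
    by exists [::]; split=> // p Pp; case: nP; exists p.
  exists [:: p]; split=> [b|q _]; first by rewrite inE => /eqP ->.
  by exists p; rewrite ?inE.
have [B [BP Bdom]] := IH P.
have [C CP] := choice (fun c => IH (fun p => P p /\ f i p = c)).
pose M := \max_(b <- B) f i b.
exists (B ++ flatten [seq C c | c <- iota 0 M]); split=> [b|p Pp].
  rewrite mem_cat => /orP[/BP //|/flattenP[s /mapP[c _ ->]]].
  by move=> /(proj1 (CP c)) [].
have [ltM|leM] := ltnP (f i p) M.
  have [b bC bp] := proj2 (CP (f i p)) p (conj Pp erefl).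
  exists b.
    rewrite mem_cat; apply/orP; right; apply/flattenP; exists (C (f i p)) => //.
    by apply/map_f; rewrite mem_iota add0n ltM.
  move=> j; rewrite inE => /predU1P[->|/bp //].
  by have [_ ->] := proj1 (CP (f i p)) b bC.
have [b bB bp] := Bdom p Pp; exists b; first by rewrite mem_cat bB.
move=> j; rewrite inE => /predU1P[->|/bp //]; apply: leq_trans leM.
by rewrite /M (big_rem b) //= leq_maxl.
Qed.

Variable N : nat.
Implicit Types (w v : 'I_N -> nat) (u : multinom N).

Definition wdeg w u := \sum_(i < N) w i * u i.
Definition wsum w := \sum_(i < N) w i.
Definition primitive w := forall d, (forall i, d %| w i) -> d = 1.

Lemma exists_max_ratio (T : eqType) (num den : T -> nat) (x0 : T) (B : seq T) :
  x0 \in B -> (forall b, b \in B -> 0 < den b) ->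
  exists2 b, b \in B &
    forall c, c \in B -> num c * den b <= num b * den c.
Proof.
elim: B x0 => // a B IH _ _ dpos.
have [->|[y yB]] : B = [::] \/ exists y, y \in B.
- by case: B {IH dpos} => [|y B]; [left | right; exists y; rewrite inE eqxx].
- by exists a; rewrite ?inE // => c; rewrite inE => /eqP ->.
have [b bB bmax] := IH y yB (fun c cB => dpos c (mem_behead (s := a :: B) cB)).
have [le_ab|lt_ba] := leqP (num a * den b) (num b * den a).
  by exists b => [|c]; rewrite inE ?bB ?orbT // => /predU1P[->|/bmax].
exists a => [|c]; rewrite inE ?eqxx // => /predU1P[-> //|cB].
have da := dpos a (mem_head _ _).
have db : 0 < den b by apply: dpos; rewrite inE bB orbT.
have dc : 0 < den c by apply: dpos; rewrite inE cB orbT.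
have := bmax c cB; nia.
Qed.

(* The integer points of the cone [t <= w.u, u in S] form a monoid with finitely
   many generators (Dickson), and the ratio [t / |w|] of a sum is at most the
   larger of the ratios of its summands. *)
Lemma exists_optimal_pair (S : seq (multinom N)) u0 : 0 < N -> u0 \in S ->
  exists w t, [/\ 0 < wsum w, forall u, u \in S -> t <= wdeg w u &
    forall v s, 0 < wsum v -> (forall u, u \in S -> s <= wdeg v u) ->
      s * wsum w <= t * wsum v].
Proof.
move=> N0 u0S.
(* Dickson's lemma needs decidable equality on pairs (w, t), which functions lack; finite functions
   provide it, and only projections and constructor are kept. *)
have [T [ex [tv [mk [exK tvK]]]]] : exists (T : eqType)
    (ex : T -> 'I_N -> nat) (tv : T -> nat) (mk : ('I_N -> nat) -> nat -> T),
    (forall w t, ex (mk w t) =1 w) /\ (forall w t, tv (mk w t) = t).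
  exists ({ffun 'I_N -> nat} * nat)%type.
  exists (fun p : {ffun 'I_N -> nat} * nat => fun i => p.1 i).
  exists (fun p : {ffun 'I_N -> nat} * nat => p.2).
  by exists (fun w t => ([ffun i => w i], t)); split=> // w t i; rewrite ffunE.
pose feas p := forall u, u \in S -> tv p <= wdeg (ex p) u.
(* The coordinates are the level t, the weights and the slacks w.u - t; domination in all of them
   puts the difference of two points back into the cone. *)
pose f (x : option ('I_N + multinom N)) p :=
  match x with None => tv p | Some (inl i) => ex p i
             | Some (inr u) => wdeg (ex p) u - tv p end.
pose D := None :: [seq Some (inl i) | i <- enum 'I_N] ++
          [seq Some (inr u) | u <- S].
have wdeg_mk w t u : wdeg (ex (mk w t)) u = wdeg w u.
  by apply: eq_bigr => i _; rewrite exK.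
have wsum_mk w t : wsum (ex (mk w t)) = wsum w.
  by apply: eq_bigr => i _; rewrite exK.
have [B [BP Bdom]] := dickson f D (fun p => 0 < wsum (ex p) /\ feas p).
have [b0 b0B _] : exists2 b, b \in B & forall i, i \in D -> f i b <=
    f i (mk (fun=> 1) 0).
  apply: Bdom; split=> [|u _]; last by rewrite tvK.
  by rewrite wsum_mk /wsum (bigD1 (Ordinal N0)).
have [b bB bmax] := @exists_max_ratio T tv (fun p => wsum (ex p)) b0 B b0B
  (fun b bB => proj1 (BP b bB)).
have [b_gt0 bfeas] := BP b bB.
exists (ex b), (tv b); split=> // v s v0 vfeas.
suff key p : feas p -> 0 < wsum (ex p) ->
    tv p * wsum (ex b) <= tv b * wsum (ex p).
  have := key (mk v s); rewrite tvK wsum_mk; apply=> // u /vfeas.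
  by rewrite tvK wdeg_mk.
(* Strong induction on |w|: subtracting a generator [c], which has positive sum, leaves a smaller
   point [q]. *)
have [n] := ubnP (wsum (ex p)); elim: n p => // n IH p ltn pfeas p0.
have [c cB cp] := Bdom p (conj p0 pfeas).
have [c0 cfeas] := BP c cB.
have cp2 : tv c <= tv p by apply: (cp None); rewrite inE.
have cp1 i : ex c i <= ex p i.
  apply: (cp (Some (inl i))); rewrite inE mem_cat /=.
  by rewrite map_f ?mem_enum.
have cps u : u \in S -> wdeg (ex c) u - tv c <= wdeg (ex p) u - tv p.
  move=> uS; apply: (cp (Some (inr u))); rewrite inE mem_cat /=.
  by rewrite [in X in _ || X]map_f ?orbT.
pose q := mk (fun i => ex p i - ex c i) (tv p - tv c).
have qs : wsum (ex q) + wsum (ex c) = wsum (ex p).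
  by rewrite wsum_mk /wsum -big_split; apply: eq_bigr => i _ /=; rewrite subnK.
have qd u : wdeg (ex q) u + wdeg (ex c) u = wdeg (ex p) u.
  rewrite wdeg_mk /wdeg -big_split; apply: eq_bigr => i _ /=.
  by rewrite -mulnDl subnK.
have qt : tv q = tv p - tv c by rewrite tvK.
have qfeas : feas q.
  move=> u uS; have := cps u uS; have := pfeas u uS; have := cfeas u uS.
  have := qd u; rewrite qt; lia.
(* A difference of weight zero has level at most 0.u0 = 0, so [p] and [c] have the same ratio. *)
have [q0|q0] := posnP (wsum (ex q)).
  have q20 : tv q = 0.
    have := qfeas u0 u0S; rewrite /wdeg big1 ?leqn0 => [/eqP //|i _].
    move/eqP: q0; rewrite sum_nat_eq0 => /forallP/(_ i)/implyP/(_ isT)/eqP ->.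
    by rewrite mul0n.
  have -> : tv p = tv c by lia.
  by rewrite -qs q0 add0n; apply: bmax.
have := bmax c cB; have := IH q _ qfeas q0.
have -> : tv p = tv q + tv c by lia.
move=> h1 h2; rewrite -qs mulnDl mulnDr leq_add //; apply: h1; lia.
Qed.

(** A normalized valuation needs a primitive weight, so the optimal pair is divided by the gcd of
    its weights. *)
Lemma exists_optimal_weight (S : seq (multinom N)) u0 : 0 < N -> u0 \in S ->
  exists w t, [/\ 0 < wsum w, primitive w,
    forall u, u \in S -> t <= wdeg w u &
    forall v s, 0 < wsum v -> (forall u, u \in S -> s <= wdeg v u) ->
      s * wsum w <= t * wsum v].
Proof.
move=> N0 u0S.
have [w [t [w0 wfeas wopt]]] := exists_optimal_pair N0 u0S.
pose g := \big[gcdn/0]_i w i.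
have gw i : g %| w i by rewrite /g (bigD1 i) //= dvdn_gcdl.
have g0 : 0 < g.
  case: (posnP g) => // g0; move: w0; rewrite /wsum big1 // => i _.
  by apply/eqP; rewrite -dvd0n -g0.
pose w' i := w i %/ g.
have ww' i : w i = w' i * g by rewrite divnK.
have sw : wsum w = wsum w' * g.
  by rewrite /wsum big_distrl /=; apply: eq_bigr => i _.
have dw u : wdeg w u = wdeg w' u * g.
  rewrite /wdeg big_distrl /=; apply: eq_bigr => i _.
  by rewrite ww' mulnAC.
have w'0 : 0 < wsum w' by move: w0; rewrite sw muln_gt0 => /andP[].
(* The level becomes the ceiling of t / g: it is still below the integers w'.u, and its multiple by
   [g] is at least t, which preserves optimality. *)
exists w', ((t + g.-1) %/ g); split=> //.
- move=> d dw'; have : d * g %| g.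
    apply: (big_ind (fun x => d * g %| x)) => [|x y dx dy|i _].
    - exact: dvdn0.
    - by rewrite dvdn_gcd dx.
    - by rewrite [in X in _ %| X]ww' dvdn_mul.
  by move=> /dvdn_leq => /(_ g0); have := dw' (Ordinal N0);
    case: d dw' => [|[|d]] // dw'; [move=> _ _;
     move: w'0; rewrite /wsum big1 // => i _; apply/eqP; rewrite -dvd0n | nia].
- move=> u /wfeas; rewrite dw => le_t.
  by rewrite -ltnS ltn_divLR // mulSn; lia.
move=> v s v0 vfeas; have := wopt v s v0 vfeas; rewrite sw => h.
have le_t : t <= (t + g.-1) %/ g * g.
  have := divn_eq (t + g.-1) g; have := ltn_pmod (t + g.-1) g0; lia.
rewrite -(leq_pmul2r g0); nia.
Qed.

End Weights.

(** * Complete integral closure *)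

(** The hypothesis says that all powers of f / g have the common denominator [c], that is, f / g is
    almost integral; the conclusion puts f / g in [D]. For g = 0 the case m = 1 gives f = 0. *)
Definition completely_integrally_closed (D : idomainType) :=
  forall c f g : D, c != 0 ->
    (forall m, exists h, c * f ^+ m = h * g ^+ m) -> exists q, f = q * g.

Lemma cic_field (F : fieldType) : completely_integrally_closed F.
Proof.
move=> c f g c0 fg; have [g0|g0] := eqVneq g 0; last first.
  by exists (f / g); rewrite mulfVK.
have [h] := fg 1%N; rewrite !expr1 g0 mulr0 => /eqP.
by rewrite mulf_eq0 (negPf c0) => /eqP ->; exists 0; rewrite mulr0.
Qed.

Lemma cic_morphism (D D' : idomainType) (f : {rmorphism D -> D'})
    (g : D' -> D) : cancel f g -> {morph g : x y / x * y} ->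
  completely_integrally_closed D' -> completely_integrally_closed D.
Proof.
move=> fK gM cicD' c x y c0 xy.
have [|m|q fx] := cicD' (f c) (f x) (f y).
- by rewrite -(rmorph0 f) (inj_eq (can_inj fK)).
- have [h e] := xy m; exists (f h).
  by rewrite -!rmorphXn -!rmorphM e.
- by exists (g q); rewrite -[x]fK fx gM fK.
Qed.

Lemma tofrac_inj (D : idomainType) : injective (@tofrac D).
Proof. by move=> x y /eqP; rewrite tofrac_eq => /eqP. Qed.

(** * Complete integral closure of polynomial rings *)

Section CicPoly.
Variable D : idomainType.
Hypothesis cicD : completely_integrally_closed D.
Local Notation F := {fraction D}.
Local Notation "p ^i" := (map_poly (@tofrac D) p) (at level 2).

Lemma map_tofrac_inj : injective (map_poly (@tofrac D)).
Proof. exact: map_inj_poly (@tofrac_inj D) (rmorph0 _). Qed.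

(** After division by the gcd, coprimality turns the relations into g'^m | c for all m, and
    comparing degrees makes g' constant. *)
Lemma cic_poly_field (K : fieldType) : completely_integrally_closed {poly K}.
Proof.
move=> c f g c0 fg; have [g0|g0] := eqVneq g 0.
  have [h] := fg 1%N; rewrite !expr1 g0 mulr0 => /eqP.
  by rewrite mulf_eq0 (negPf c0) => /eqP ->; exists 0; rewrite mulr0.
suff /dvdpP : g %| f by [].
pose d := gcdp f g.
have d0 : d != 0 by rewrite gcdp_eq0 negb_and g0 orbT.
pose f' := f %/ d; pose g' := g %/ d.
have fE : f = f' * d by rewrite divpK ?dvdp_gcdl.
have gE : g = g' * d by rewrite divpK ?dvdp_gcdr.
have cop : coprimep g' f'.
  by rewrite coprimep_sym coprimep_div_gcd ?g0 ?orbT.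
have dvd m : g' ^+ m %| c.
  rewrite -(Gauss_dvdpl _ (q := f' ^+ m)) ?coprimep_expl ?coprimep_expr //.
  have [h e] := fg m; apply/dvdpP; exists h.
  apply: (mulIf (expf_neq0 m d0)); rewrite -!mulrA -!exprMn -fE -gE //.
have g'1 : (size g' <= 1)%N.
  rewrite leqNgt; apply/negP => g'1.
  have := dvdp_leq c0 (dvd (size c)); have := size_exp g' (size c).
  have : (0 < size c)%N by rewrite size_poly_gt0.
  move: (size c) (size (g' ^+ _)) (size g') g'1 => x y z; nia.
have g'0 : g' != 0 by apply: contraNneq g0 => e; rewrite gE e mul0r.
have /size_poly1P[a a0 ga] : size g' == 1%N.
  by rewrite eqn_leq g'1 size_poly_gt0.
rewrite fE gE dvdp_mul // ga; apply/dvdpP; exists (f' * (a^-1)%:P).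
by rewrite -mulrA -polyCM mulVf // mulr1.
Qed.

(** The leading coefficient of [q] is almost integral over [D], with denominator the leading
    coefficient of [c], hence lies in [D]. Removing the leading term lowers the size. *)
Lemma almost_integral_poly (c : {poly D}) n (q : {poly F}) : c != 0 ->
  (size q <= n)%N ->
  (forall m, exists h, c^i * q ^+ m = h^i) -> exists p, q = p^i.
Proof.
move=> c0; elim: n q => [|n IH] q.
  by rewrite leqn0 size_poly_eq0 => /eqP -> _; exists 0; rewrite rmorph0.
move=> qn qint; have [q0|q0] := eqVneq q 0.
  by exists 0; rewrite rmorph0.
pose a := \n_(repr (lead_coef q)); pose b := \d_(repr (lead_coef q)).
have b0 : tofrac b != 0 by rewrite tofrac_eq0 denom_ratioP.
have qE : lead_coef q = tofrac a / tofrac b by rewrite tofrac_repr.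
have [|m|r rE] := cicD (c := lead_coef c) (f := a) (g := b).
- by rewrite lead_coef_eq0.
- have [h e] := qint m; exists (lead_coef h); apply: tofrac_inj.
  rewrite !rmorphM !rmorphXn /= -!lead_coef_map_inj ?rmorph0 //;
    try exact: tofrac_inj.
  rewrite -e lead_coefM lead_coef_exp qE expr_div_n -mulrA.
  by rewrite divfK ?expf_neq0.
have lq : lead_coef q = tofrac r by rewrite qE rE rmorphM mulfK.
pose s := r *: 'X^((size q).-1) : {poly D}.
have sE : s^i = lead_coef q *: 'X^((size q).-1).
  by rewrite map_polyZ /= map_polyXn lq.
have [||p pE] := IH (q - s^i).
- rewrite -ltnS; apply: leq_trans qn; rewrite sE.
  have sq : size q = (size q).-1.+1 by rewrite prednK // lt0n size_poly_eq0.
  rewrite [X in (_ < X)%N]sq ltnS; apply/leq_sizeP => j lej.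
  rewrite coefB coefZ coefXn; have [->|nj] := eqVneq j (size q).-1.
    by rewrite mulr1 subrr.
  rewrite mulr0 subr0 nth_default // sq ltn_neqAle eq_sym nj lej //.
(* Mixed products are needed because a factor q - s splits into q and s, which raises the exponent
   of [q]. *)
- suff H m j : exists h, c^i * (q ^+ j * (q - s^i) ^+ m) = h^i.
    by move=> m; have [h] := H m 0; rewrite expr0 mul1r; exists h.
  elim: m j => [|m IHm] j; first by rewrite expr0 mulr1; apply: qint.
  have [h1 e1] := IHm j.+1; have [h2 e2] := IHm j.
  exists (h1 - s * h2); rewrite rmorphB rmorphM /= -e1 -e2 !exprS.
  by ring.
- by exists (p + s); rewrite rmorphD /= -pE subrK.
Qed.

(** The quotient exists over the fraction field and is almost integral over the polynomials with
    coefficients in [D], so its coefficients lie in [D]. *)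
Lemma cic_poly : completely_integrally_closed {poly D}.
Proof.
move=> c f g c0 fg; have [g0|g0] := eqVneq g 0.
  have [h] := fg 1%N; rewrite !expr1 g0 mulr0 => /eqP.
  by rewrite mulf_eq0 (negPf c0) => /eqP ->; exists 0; rewrite mulr0.
have i0 x : (x^i == 0) = (x == 0).
  by rewrite -(inj_eq map_tofrac_inj) rmorph0.
have [|m|q qE] := @cic_poly_field F c^i f^i g^i; first by rewrite i0.
  by have [h e] := fg m; exists h^i; rewrite -!rmorphXn -!rmorphM e.
have [|m|p pE] := @almost_integral_poly c (size q) q c0 _ _; first by [].
  have [h e] := fg m; exists h.
  have gm0 : (g ^+ m)^i != 0 by rewrite i0 expf_neq0.
  apply: (mulIf gm0); rewrite -rmorphM -e rmorphM !rmorphXn /= qE exprMn.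
  by rewrite -mulrA.
by exists p; apply: map_tofrac_inj; rewrite qE pE rmorphM.
Qed.

End CicPoly.

Lemma cic_mpoly (k : fieldType) n : completely_integrally_closed (mpoly n k).
Proof.
elim: n => [|n IH].
  have fK : cancel (@mcoeff 0 k (@mnm0 0)) (@mpolyC 0 k).
    by move=> x; rewrite [RHS]nvar0_mpolyC.
  apply: (cic_morphism (D' := k) fK); last exact: cic_field.
  exact: mpolyCM.
(* The inverse of [muni]: coefficients are widened and the polynomial variable becomes the last
   one. *)
pose g (p : {poly mpoly n k}) : mpoly n.+1 k :=
  (map_poly (@mwiden n k) p).[@mpolyX _ k (mnm1 ord_max)].
have gM : {morph g : p q / p * q} by move=> p q; rewrite /g rmorphM hornerM.
apply: (cic_morphism (f := @muni n k) _ gM (cic_poly IH)) => p.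
rewrite /= muniE.
rewrite [RHS]mpolyE /g rmorph_sum horner_sum /=; apply: eq_bigr => m _.
rewrite map_polyZ map_polyXn hornerZ hornerXn /= mwidenZ mwidenX -scalerAl.
congr (_ *: _); rewrite mpolyXn -mpolyXD; congr (mpolyX _ _).
apply/mnmP => i; rewrite mnmDE mulmnE mnm1E.
have [j ->|->] := unliftP ord_max i.
  have -> : lift ord_max j = widen_ord (leqnSn n) j by exact/val_inj/lift_max.
  rewrite mnmwiden_widen mnmE eqE /= (gtn_eqF (ltn_ord j)) mul0n addn0 //.
by rewrite mnmwiden_ordmax eqxx mul1n.
Qed.

(** * Integral elements with a prescribed denominator *)

Section CicIntegral.
Variable D : idomainType.
Hypothesis cicD : completely_integrally_closed D.
Local Notation K := {fraction D}.

Definition is_num (x : K) := exists h, x = tofrac h.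

Lemma is_numD x y : is_num x -> is_num y -> is_num (x + y).
Proof. by move=> [a ->] [b ->]; exists (a + b); rewrite tofracD. Qed.

Lemma is_numM x y : is_num x -> is_num y -> is_num (x * y).
Proof. by move=> [a ->] [b ->]; exists (a * b); rewrite tofracM. Qed.

Lemma is_numN x : is_num x -> is_num (- x).
Proof. by move=> [a ->]; exists (- a); rewrite tofracN. Qed.

Lemma is_num_sum (I : Type) (r : seq I) (P : pred I) (F : I -> K) :
  (forall i, P i -> is_num (F i)) -> is_num (\sum_(i <- r | P i) F i).
Proof.
move=> h; apply: (big_ind is_num) => //; last exact: is_numD.
by exists 0; rewrite tofrac0.
Qed.

Lemma monic_root_expansion (F : fieldType) (q : {poly F}) x :
  q \is monic -> root q x ->
  exists2 d, (0 < d)%N & x ^+ d = - \sum_(i < d) q`_i * x ^+ i.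
Proof.
move=> qm /rootP qx; have q0 : q != 0 by exact: monic_neq0.
have sq : size q = (size q).-1.+1 by rewrite prednK // size_poly_gt0.
exists (size q).-1.
  rewrite lt0n; apply: contra_eq_neq qx => sq0.
  have q1 : q = 1.
    have s1 : (size q <= 1)%N by rewrite sq sq0.
    move: qm; rewrite monicE lead_coefE sq0 => /eqP q01.
    by rewrite (size1_polyC s1) q01.
  by rewrite q1 hornerC oner_neq0.
move: qx; rewrite (@horner_coef_wide _ (size q).-1.+1) ?[X in (X <= _)%N]sq //.
rewrite big_ord_recr /=; move: qm; rewrite monicE lead_coefE => /eqP ->.
rewrite mul1r addrC => /eqP.
by rewrite addr_eq0 => /eqP.
Qed.

(* For [x = f / g], an equation of degree [d] bounds the denominators of all the
   powers of [s x] by [g ^ d]. *)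
Lemma cic_integral (s : D) (x : K) (q : {poly K}) : q \is monic -> root q x ->
  (forall i, is_num (tofrac s * q`_i)) -> is_num (tofrac s * x).
Proof.
move=> qm qx qs; have [d d0 xd] := monic_root_expansion qm qx.
pose f := \n_(repr x); pose g := \d_(repr x).
have g0 : g != 0 by exact: denom_ratioP.
have xE : x = tofrac f / tofrac g by rewrite tofrac_repr.
have g0' : tofrac g != 0 by rewrite tofrac_eq0.
have bounded m : is_num (tofrac g ^+ d * (tofrac s * x) ^+ m).
  have [n] := ubnP m; elim: n m => // n IH m; rewrite ltnS => lemn.
  have [lt|le] := ltnP m d.
    exists (g ^+ (d - m) * (s * f) ^+ m).
    rewrite tofracM !tofracXn tofracM xE !exprMn exprVn.
    have -> : tofrac g ^+ d = tofrac g ^+ (d - m) * tofrac g ^+ m.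
      by rewrite -exprD subnK // ltnW.
    have gm0 : tofrac g ^+ m != 0 by rewrite expf_neq0.
    rewrite [_ / tofrac g ^+ m]mulrC [tofrac s ^+ m * _]mulrCA.
    by rewrite -mulrA [tofrac g ^+ m * _]mulrA divff // mul1r.
  (* The equation replaces x^d in x^m. Of the factors s^m, one clears the coefficient of index i and
     m - d + i go with the remaining power of x, so that d - i - 1 are left over. *)
  have -> : tofrac g ^+ d * (tofrac s * x) ^+ m =
      - \sum_(i < d) (tofrac s * q`_i) * tofrac s ^+ (d - i.+1) *
          (tofrac g ^+ d * (tofrac s * x) ^+ (m - d + i)).
    have xm : x ^+ m = x ^+ (m - d) * x ^+ d by rewrite -exprD subnK.
    rewrite exprMn xm xd !mulrN !mulr_sumr.
    congr (- _); apply: eq_bigr => i _.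
    have -> : tofrac s ^+ m =
        tofrac s * tofrac s ^+ (d - i.+1) * tofrac s ^+ (m - d + i).
      rewrite -exprS -exprD; congr (_ ^+ _); have := ltn_ord i; lia.
    rewrite exprMn [x ^+ (m - d + i)]exprD.
    move: (tofrac g ^+ d) (tofrac s) (tofrac s ^+ (d - i.+1)) q`_i.
    move: (tofrac s ^+ (m - d + i)) (x ^+ (m - d)) (x ^+ i).
    by move=> a b c e h l o; ring.
  apply/is_numN/is_num_sum => i _; apply: is_numM.
    apply: is_numM; first exact: qs.
    by exists (s ^+ (d - i.+1)); rewrite tofracXn.
  by apply: IH; have := ltn_ord i; lia.
have [|m|h sf] := cicD (c := g ^+ d) (f := s * f) (g := g).
- exact: expf_neq0.
- have [h hE] := bounded m; exists h; apply: tofrac_inj.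
  rewrite (tofracM h) -hE tofracM !tofracXn tofracM -mulrA -exprMn xE.
  by rewrite -[_ * _ * tofrac g]mulrA divfK.
- by exists h; rewrite xE mulrA -tofracM sf tofracM mulfK.
Qed.

End CicIntegral.

(** * Monomial valuations *)

Section OrderAtZero.
Variable D : idomainType.
Implicit Types p q : {poly D}.

(** The order of vanishing at 0, read off the list of coefficients; its value at the zero polynomial
    is 0. *)
Definition ord0p p := find (predC1 0) p.

Lemma coef_lt_ord0p p i : (i < ord0p p)%N -> p`_i = 0.
Proof. by move/(before_find 0)/negbFE/eqP. Qed.

Lemma coef_ord0p p : p != 0 -> p`_(ord0p p) != 0.
Proof.
move=> p0; suff h : has (predC1 0) p by exact: (nth_find 0 h).
apply/hasP; exists (lead_coef p) => /=; last by rewrite lead_coef_eq0.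
by rewrite mem_nth // prednK // lt0n size_poly_eq0.
Qed.

Lemma ord0p_mulXn p n : p`_0 != 0 -> ord0p (p * 'X^n) = n.
Proof.
move=> p0; have pX0 : p * 'X^n != 0.
  by apply: contraNneq p0 => /(congr1 (fun q : {poly D} => q`_n));
    rewrite coefMXn ltnn subnn coef0 => ->.
apply/eqP; rewrite eqn_leq; apply/andP; split; rewrite leqNgt; apply/negP.
  by move/coef_lt_ord0p/eqP; rewrite coefMXn ltnn subnn (negPf p0).
by move=> lt; have := coef_ord0p pX0; rewrite coefMXn lt eqxx.
Qed.

Lemma ord0p_factor p : p != 0 ->
  exists2 q : {poly D}, q`_0 != 0 & p = q * 'X^(ord0p p).
Proof.
move=> p0; exists (drop_poly (ord0p p) p).
  by rewrite coef_drop_poly coef_ord0p.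
apply/polyP => i; rewrite coefMXn coef_drop_poly.
by case: ltnP => [/coef_lt_ord0p|/subnK ->].
Qed.

Lemma ord0pM p q : p != 0 -> q != 0 -> ord0p (p * q) = (ord0p p + ord0p q)%N.
Proof.
move=> /ord0p_factor[p' p'0 pE] /ord0p_factor[q' q'0 qE].
rewrite {1}pE {1}qE mulrACA -exprD ord0p_mulXn // coefM big_ord1 subn0.
by rewrite mulf_neq0.
Qed.

End OrderAtZero.

Section MonomialValuation.
Variables (k : fieldType) (N : nat) (w : 'I_N -> nat).
Local Notation A := (mpoly N k).
Local Notation K := (funField k N).
Local Notation X i := (@mpolyX N k (mnm1 i)).
Implicit Types (f g : A) (x y : K) (u : multinom N).

(** The substitution X_i -> X_i T^(w_i). The coefficient of T^d is the weighted homogeneous part of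
    degree d, so the weighted order is a T-adic order, and its multiplicativity is that of the order
    over a domain. *)
Definition wscale f : {poly A} :=
  mmap (polyC \o mpolyC N (R := k)) (fun i => (X i)%:P * 'X^(w i)) f.

Lemma wscaleM : {morph wscale : f g / f * g}.
Proof. exact: rmorphM. Qed.

Lemma mcoeff_wscale f u d :
  mcoeff u (wscale f)`_d = if wdeg w u == d then mcoeff u f else 0.
Proof.
have wX m : mmap1 (fun i => (X i)%:P * 'X^(w i)) m =
    (mpolyX k m)%:P * 'X^(wdeg w m) :> {poly A}.
  rewrite /mmap1 mpolyXE_id rmorph_prod.
  rewrite /wdeg [in RHS](big_morph _ (exprD 'X) (expr0 _)) -big_split /=.
  by apply: eq_bigr => i _; rewrite exprMn rmorphXn -exprM.
rewrite /wscale /mmap coef_sum raddf_sum /=.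
rewrite (eq_bigr (fun m => if wdeg w u == d then
   mcoeff m f * (m == u)%:R else 0)) => [|m _]; last first.
  rewrite wX mulrA -polyCM coefMXn coefC subn_eq0.
  have [->|ne] := eqVneq m u.
    rewrite eqn_leq; case: ltnP => //= _; rewrite ?raddf0 //.
    by case: leqP; rewrite ?raddf0 // mcoeffCM mcoeffX eqxx.
  rewrite mulr0 if_same; do 2?case: ifP; rewrite ?raddf0 // => _ _.
  by rewrite mcoeffCM mcoeffX (negPf ne) mulr0.
case: ifP => _; last by rewrite big1.
have [uf|uf] := boolP (u \in msupp f).
  rewrite (bigD1_seq u) ?msupp_uniq //= eqxx mulr1 big1 ?addr0 // => m.
  by move/negPf ->; rewrite mulr0.
rewrite (memN_msupp_eq0 uf) big_seq big1 // => m mf.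
by case: eqVneq mf uf => [-> ->|] //; rewrite mulr0.
Qed.

Lemma wscale_eq0 f : (wscale f == 0) = (f == 0).
Proof.
apply/eqP/eqP => [f0|->]; last exact: mmap0.
apply/mpolyP => u; rewrite mcoeff0.
by have := mcoeff_wscale f u (wdeg w u); rewrite f0 coef0 mcoeff0 eqxx.
Qed.

Fact word_key : unit. Proof. by []. Qed.

Definition word : A -> nat := locked_with word_key (fun f => ord0p (wscale f)).

Lemma wordE f : word f = ord0p (wscale f).
Proof. by rewrite /word unlock. Qed.

Lemma wordM f g : f != 0 -> g != 0 -> word (f * g) = (word f + word g)%N.
Proof. by move=> f0 g0; rewrite !wordE wscaleM ord0pM ?wscale_eq0. Qed.

Lemma word_le f u : u \in msupp f -> (word f <= wdeg w u)%N.
Proof.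
rewrite mcoeff_msupp => fu; rewrite wordE leqNgt.
apply: contra fu => /coef_lt_ord0p f0.
by have := mcoeff_wscale f u (wdeg w u); rewrite f0 mcoeff0 eqxx => <-.
Qed.

Lemma word_attained f : f != 0 -> exists2 u, u \in msupp f & word f = wdeg w u.
Proof.
rewrite -wscale_eq0 => /coef_ord0p; rewrite -wordE => f0.
have [u] : exists u, mcoeff u (wscale f)`_(word f) != 0.
  apply/not_existsP => h; case/negP: f0; apply/eqP/mpolyP => u.
  by rewrite mcoeff0; apply/eqP/negPn/negP/h.
rewrite mcoeff_wscale; case: ifP => [/eqP <-|_]; last by rewrite eqxx.
by rewrite -mcoeff_msupp; exists u.
Qed.

Lemma leq_word f n : f != 0 ->
  (forall u, u \in msupp f -> (n <= wdeg w u)%N) -> (n <= word f)%N.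
Proof. by move=> f0 h; have [u /h ? ->] := word_attained f0. Qed.

Fact wval_key : unit. Proof. by []. Qed.

Definition wval : K -> int := locked_with wval_key
  (fun x => (word \n_(repr x))%:Z - (word \d_(repr x))%:Z).

Lemma wvalE x : wval x = (word \n_(repr x))%:Z - (word \d_(repr x))%:Z.
Proof. by rewrite /wval unlock. Qed.

Lemma frac_num_den x : exists f g, g != 0 /\ x = tofrac f / tofrac g.
Proof.
exists \n_(repr x), \d_(repr x); split; first exact: denom_ratioP.
by rewrite tofrac_repr.
Qed.

Lemma wval_frac f g : f != 0 -> g != 0 ->
  wval (tofrac f / tofrac g) = (word f)%:Z - (word g)%:Z.
Proof.
move=> f0 g0; set x := _ / _; rewrite wvalE.
have xE : tofrac \n_(repr x) / tofrac \d_(repr x) = x by rewrite tofrac_repr.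
have d0 : \d_(repr x) != 0 by exact: denom_ratioP.
have n0 : \n_(repr x) != 0.
  rewrite -tofrac_eq0; apply: contraTneq isT => e.
  have : x != 0 by rewrite mulf_neq0 ?invr_eq0 ?tofrac_eq0.
  by rewrite -xE e mul0r eqxx.
have /(congr1 word) : \n_(repr x) * g = f * \d_(repr x).
  by apply/tofrac_inj/eqP; rewrite !tofracM -eqr_div ?tofrac_eq0 // xE.
rewrite (wordM n0 g0) (wordM f0 d0); move: (word _) (word _) (word _) (word _).
by move=> a b c d; lia.
Qed.

Lemma wval_tofrac f : f != 0 -> wval (tofrac f) = (word f)%:Z.
Proof.
have word1 : word 1 = 0%N.
  have := @wordM 1 1 (oner_neq0 _) (oner_neq0 _); rewrite mulr1.
  by move: (word 1) => n; lia.
move=> f0; rewrite -[tofrac f]divr1 -tofrac1 wval_frac ?oner_neq0 // word1.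
by rewrite subr0.
Qed.

Lemma wvalM x y : x != 0 -> y != 0 -> wval (x * y) = wval x + wval y.
Proof.
have [f [g [g0 ->]]] := frac_num_den x.
have [f' [g' [g'0 ->]]] := frac_num_den y.
rewrite !mulf_eq0 !invr_eq0 !tofrac_eq0 !negb_or => /andP[f0 _] /andP[f'0 _].
rewrite mulrACA -invfM -!tofracM (wval_frac f0 g0) (wval_frac f'0 g'0).
rewrite (wval_frac (mulf_neq0 f0 f'0) (mulf_neq0 g0 g'0)) (wordM f0 f'0).
rewrite (wordM g0 g'0); move: (word _) (word _) (word _) (word _).
by move=> a b c d; lia.
Qed.

Lemma wval1 : wval 1 = 0.
Proof.
have := @wvalM 1 1 (oner_neq0 _) (oner_neq0 _); rewrite mulr1.
by move: (wval 1) => n; lia.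
Qed.

Lemma wvalV x : x != 0 -> wval x^-1 = - wval x.
Proof.
move=> x0; have := wvalM x0 (invr_neq0 x0); rewrite divff // wval1.
by move: (wval _) (wval _) => a b; lia.
Qed.

Lemma wvalD x y : x != 0 -> y != 0 -> x + y != 0 ->
  Order.min (wval x) (wval y) <= wval (x + y).
Proof.
have [f [g [g0 ->]]] := frac_num_den x.
have [f' [g' [g'0 ->]]] := frac_num_den y.
rewrite !mulf_eq0 !invr_eq0 !tofrac_eq0 !negb_or => /andP[f0 _] /andP[f'0 _].
rewrite addf_div ?tofrac_eq0 // -!tofracM -tofracD.
rewrite !mulf_eq0 !invr_eq0 !tofrac_eq0 !negb_or => /andP[h0 _].
rewrite (wval_frac f0 g0) (wval_frac f'0 g'0).
rewrite (wval_frac h0 (mulf_neq0 g0 g'0)) (wordM g0 g'0).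
have : (minn (word (f * g')%R) (word (f' * g)%R) <= word (f * g' + f' * g)%R)%N.
  apply: leq_word => // u /msuppD_le; rewrite mem_cat geq_min.
  by case/orP => uf; apply/orP; [left | right]; exact: word_le uf.
rewrite (wordM f0 g'0) (wordM f'0 g0).
by move: (word _) (word _) (word _) (word _) (word _) => a b c d e; lia.
Qed.

(* [wval x >= n], with [wval 0 = +oo]. *)
Definition vge (n : int) x := (x == 0) || (n <= wval x).

Lemma vge0 n : vge n 0. Proof. by rewrite /vge eqxx. Qed.

Lemma vgeE n x : x != 0 -> vge n x = (n <= wval x).
Proof. by rewrite /vge => /negPf ->. Qed.

Lemma vgeD n x y : vge n x -> vge n y -> vge n (x + y).
Proof.
have [->|x0] := eqVneq x 0; first by rewrite add0r.
have [->|y0] := eqVneq y 0; first by rewrite addr0.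
have [->|xy0] := eqVneq (x + y) 0; first by move=> _ _; exact: vge0.
rewrite (vgeE n x0) (vgeE n y0) (vgeE n xy0) => nx ny.
apply: le_trans (wvalD x0 y0 xy0).
by rewrite le_min nx.
Qed.

Lemma vgeM m n x y : vge m x -> vge n y -> vge (m + n) (x * y).
Proof.
have [->|x0] := eqVneq x 0; first by rewrite mul0r => _ _; exact: vge0.
have [->|y0] := eqVneq y 0; first by rewrite mulr0 => _ _; exact: vge0.
rewrite (vgeE m x0) (vgeE n y0) (vgeE _ (mulf_neq0 x0 y0)) (wvalM x0 y0).
exact: lerD.
Qed.

Lemma vge_le m n x : m <= n -> vge n x -> vge m x.
Proof. by rewrite /vge => mn /orP[->//|/(le_trans mn) ->]; rewrite orbT. Qed.

Lemma vge_tofrac n f :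
  (forall u, u \in msupp f -> (n <= wdeg w u)%N) -> vge n%:Z (tofrac f).
Proof.
have [->|f0 h] := eqVneq f 0; first by rewrite tofrac0 vge0.
by rewrite vgeE ?tofrac_eq0 // wval_tofrac // lez_nat leq_word.
Qed.

Lemma vge_word f : vge (word f)%:Z (tofrac f).
Proof. by apply: vge_tofrac => u /word_le. Qed.

Lemma vge_poly f : vge 0 (tofrac f).
Proof. by apply: vge_le (vge_word f). Qed.

Lemma vge1 : vge 0 1. Proof. by rewrite -tofrac1 vge_poly. Qed.

Lemma vge_int (z : int) : vge 0 z%:~R.
Proof.
have -> : z%:~R = tofrac (z%:~R : A) by rewrite rmorph_int.
exact: vge_poly.
Qed.

Lemma vgeN n x : vge n (- x) = vge n x.
Proof.
have H y : vge n y -> vge n (- y).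
  move=> ny; rewrite -mulN1r -[n]add0r; apply: vgeM ny.
  exact: (vge_int (-1)).
by apply/idP/idP => /H //; rewrite opprK.
Qed.

Lemma vgeB n x y : vge n x -> vge n y -> vge n (x - y).
Proof. by move=> nx ny; rewrite vgeD // vgeN. Qed.

Lemma vge_sum (I : Type) (r : seq I) (P : pred I) (F : I -> K) n :
  (forall i, P i -> vge n (F i)) -> vge n (\sum_(i <- r | P i) F i).
Proof.
by move=> h; apply: (big_ind (vge n)) => //; [exact: vge0 | exact: vgeD].
Qed.

Lemma vge_prod (I : Type) (r : seq I) (P : pred I) (F : I -> K) :
  (forall i, P i -> vge 0 (F i)) -> vge 0 (\prod_(i <- r | P i) F i).
Proof.
move=> h; apply: (big_ind (vge 0)) => //; first exact: vge1.
by move=> x y x0 y0; have := vgeM x0 y0; rewrite addr0.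
Qed.

End MonomialValuation.

(** * Derivations and discrepancies *)

Section QuotientRule.
Variable F : fieldType.
Variables f g f1 g1 f' g' f1' g1' : F.
Hypotheses (g0 : g != 0) (g10 : g1 != 0).

Lemma quotient_ruleM :
  ((f' * f1 + f * f1') * (g * g1) - f * f1 * (g' * g1 + g * g1')) /
    (g * g1) ^+ 2 =
  (f' * g - f * g') / g ^+ 2 * (f1 / g1) +
    f / g * ((f1' * g1 - f1 * g1') / g1 ^+ 2).
Proof. by field; rewrite g0 g10. Qed.

Lemma log_derivativeM :
  (f * g1 + g * f1) / (g * g1) = f / g + f1 / g1.
Proof. by field; rewrite g0 g10. Qed.

End QuotientRule.

(** * Homomorphisms from the multiplicative group of a field, such as valuations and logarithmic
    derivatives *)

Section LogMorphism.
Variables (F : fieldType) (V : zmodType) (h : F -> V).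
Hypothesis hM : forall x y, x != 0 -> y != 0 -> h (x * y) = h x + h y.

Lemma logmorph1 : h 1 = 0.
Proof. by apply: (addrI (h 1)); rewrite -hM ?oner_neq0 // mulr1 addr0. Qed.

Lemma logmorphV x : x != 0 -> h x^-1 = - h x.
Proof.
move=> x0; apply: (addrI (h x)).
by rewrite subrr -hM ?invr_eq0 // divff // logmorph1.
Qed.

Lemma logmorph_exprz x (z : int) : x != 0 -> h (x ^ z) = h x *~ z.
Proof.
move=> x0; have hn n : h (x ^+ n) = h x *+ n.
  elim: n => [|n IH]; first by rewrite expr0 logmorph1.
  by rewrite exprS mulrS hM ?expf_neq0 // IH.
case: z => n; first exact: hn.
have -> : x ^ Negz n = (x ^+ n.+1)^-1 by [].
by rewrite logmorphV ?expf_neq0 // hn NegzE mulrNz.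
Qed.

Lemma logmorph_prod (I : Type) (r : seq I) (x : I -> F) :
  (forall i, x i != 0) -> h (\prod_(i <- r) x i) = \sum_(i <- r) h (x i).
Proof.
move=> x0; suff [] : \prod_(i <- r) x i != 0 /\
    h (\prod_(i <- r) x i) = \sum_(i <- r) h (x i) by [].
elim/big_rec2: _ => [|i s y _ [y0 hy]]; first by rewrite logmorph1 oner_neq0.
by rewrite mulf_neq0 // hM // hy.
Qed.

End LogMorphism.

Section Derivations.
Variables (k : fieldType) (N : nat).
Local Notation A := (mpoly N k).
Local Notation K := (funField k N).
Implicit Types (f g : A) (x y : K) (i j : 'I_N).

Definition xvar i : K := tofrac (@mpolyX N k (mnm1 i)).

Lemma mpolyX_neq0 u : @mpolyX N k u != 0.
Proof. by rewrite -msupp_eq0 msuppX. Qed.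

Lemma xvar_neq0 i : xvar i != 0.
Proof. by rewrite tofrac_eq0 mpolyX_neq0. Qed.

Lemma fderiv_tofrac i f : fderiv i (tofrac f) = tofrac (mderiv i f).
Proof.
rewrite -[tofrac f]divr1 -tofrac1 fderiv_frac ?oner_neq0 // expr1n tofrac1.
by rewrite divr1 -[1]mpolyC1 mderivC mulr0 subr0 mpolyC1 mulr1.
Qed.

Lemma fderiv_xvar i j : fderiv i (xvar j) = (i == j)%:R.
Proof.
rewrite fderiv_tofrac mderivX mnm1E eq_sym; case: eqVneq => [->|_]; last first.
  by rewrite scale0r tofrac0.
rewrite scale1r (_ : mnm_sub _ _ = mnm0) ?mpolyX0 ?tofrac1 //.
by apply/mnmP => l; rewrite mnmBE mnm0E subnn.
Qed.

Lemma fderivM i x y : fderiv i (x * y) = fderiv i x * y + x * fderiv i y.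
Proof.
have [f [g [g0 ->]]] := frac_num_den x.
have [f' [g' [g'0 ->]]] := frac_num_den y.
rewrite mulrACA -invfM -!tofracM.
rewrite (fderiv_frac _ _ g0) (fderiv_frac _ _ g'0).
rewrite (fderiv_frac _ _ (mulf_neq0 g0 g'0)) !mderivM.
rewrite !(tofracB, tofracD, tofracM, tofracXn).
by apply: quotient_ruleM; rewrite tofrac_eq0.
Qed.

Lemma fderiv0 i : fderiv i (0 : K) = 0.
Proof. by rewrite -tofrac0 fderiv_tofrac mderiv0. Qed.

Definition dlog i x := fderiv i x / x.

Lemma dlogM i x y : x != 0 -> y != 0 -> dlog i (x * y) = dlog i x + dlog i y.
Proof.
by move=> x0 y0; rewrite /dlog fderivM; exact: (log_derivativeM _ _ x0 y0).
Qed.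

Definition lmon (m : 'I_N -> int) : K := \prod_i xvar i ^ m i.

Lemma lmon_neq0 m : lmon m != 0.
Proof. by apply/prodf_neq0 => i _; rewrite expfz_neq0 // xvar_neq0. Qed.

Lemma lmonD m n : lmon (fun i => m i + n i) = lmon m * lmon n.
Proof.
rewrite -big_split; apply: eq_bigr => i _ /=.
by rewrite expfzDr // xvar_neq0.
Qed.

Lemma lmonN m : lmon (fun i => - m i) = (lmon m)^-1.
Proof.
by rewrite /lmon -prodfV; apply: eq_bigr => i _; rewrite -invr_expz.
Qed.

Lemma lmon_nat (u : multinom N) :
  lmon (fun i => (u i)%:Z) = tofrac (mpolyX k u).
Proof.
by rewrite mpolyXE_id rmorph_prod; apply: eq_bigr => i _; rewrite rmorphXn.
Qed.

Lemma logmorph_lmon (V : zmodType) (h : K -> V) m :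
  (forall x y, x != 0 -> y != 0 -> h (x * y) = h x + h y) ->
  h (lmon m) = \sum_i h (xvar i) *~ m i.
Proof.
move=> hM; rewrite /lmon logmorph_prod // => [|i].
  by apply: eq_bigr => i _; rewrite logmorph_exprz // xvar_neq0.
by rewrite expfz_neq0 // xvar_neq0.
Qed.

Lemma dlog_lmon j m : dlog j (lmon m) = (m j)%:~R / xvar j.
Proof.
rewrite logmorph_lmon; last exact: dlogM.
rewrite (bigD1 j) //= big1 => [|i ij].
  by rewrite /dlog fderiv_xvar eqxx addr0 div1r mulrzl.
by rewrite /dlog fderiv_xvar eq_sym (negPf ij) mul0r mul0rz.
Qed.

Lemma fderiv_lmon j m : fderiv j (lmon m) = (m j)%:~R / xvar j * lmon m.
Proof. by rewrite -dlog_lmon /dlog divfK ?lmon_neq0. Qed.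

(** The logarithmic derivation X_i d/dX_i sends X^u to u_i X^u. It creates no new exponents, so
    unlike d/dX_i it never lowers a weighted order. *)
Definition xderiv i f : A := mpolyX k (mnm1 i) * mderiv i f.

Lemma mcoeff_xderiv i f u : mcoeff u (xderiv i f) = mcoeff u f *+ u i.
Proof.
rewrite /xderiv mulrC; have [u0|u0] := eqVneq (u i) 0%N.
  rewrite u0 mulr0n; apply/memN_msupp_eq0/negP.
  rewrite (perm_mem (msuppMX _ _)) => /mapP[v _ uE].
  by move: u0; rewrite uE mnmDE mnm1E eqxx.
have uE : mnm_add (mnm_sub u (mnm1 i)) (mnm1 i) = u.
  by rewrite submK // lep1mP.
rewrite -{1}uE addmC mcoeffMX mcoeff_deriv uE mnmBE mnm1E eqxx subn1.
by rewrite prednK ?lt0n.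
Qed.

Lemma xvar_fderiv_frac i f g : g != 0 ->
  xvar i * fderiv i (tofrac f / tofrac g) =
    tofrac (xderiv i f * g - f * xderiv i g) / tofrac g ^+ 2.
Proof.
move=> g0; rewrite fderiv_frac // mulrA tofracXn -tofracM; congr (tofrac _ / _).
rewrite /xderiv; move: (mpolyX _ _) (mderiv i f) (mderiv i g) => x f' g'.
ring.
Qed.

Section WeightedOrder.
Variable w : 'I_N -> nat.
Local Notation vge := (vge w).

Lemma vge_divsq n x g : g != 0 -> vge (n + (word w g)%:Z *+ 2) x ->
  vge n (x / tofrac g ^+ 2).
Proof.
move=> g0 vx; have : vge (- ((word w g)%:Z *+ 2)) (tofrac g ^+ 2)^-1.
  rewrite vgeE ?invr_eq0 ?expf_neq0 ?tofrac_eq0 //.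
  rewrite wvalV ?expf_neq0 ?tofrac_eq0 // expr2 wvalM ?tofrac_eq0 //.
  by rewrite wval_tofrac // mulr2n.
by move/(vgeM vx); rewrite addrK.
Qed.

Lemma vge_xderiv i f : vge (word w f)%:Z (tofrac (xderiv i f)).
Proof.
apply: vge_tofrac => u; rewrite mcoeff_msupp mcoeff_xderiv => fu.
apply: word_le; rewrite mcoeff_msupp; apply: contraNneq fu => ->.
by rewrite mul0rn.
Qed.

Lemma vge_xvar_fderiv n i x : vge n x -> vge n (xvar i * fderiv i x).
Proof.
have [->|] := eqVneq x 0; first by rewrite fderiv0 mulr0.
have [f [g [g0 ->]]] := frac_num_den x.
rewrite mulf_eq0 invr_eq0 !tofrac_eq0 negb_or => /andP[f0 _].
rewrite vgeE ?mulf_neq0 ?invr_eq0 ?tofrac_eq0 // wval_frac // => nfg.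
rewrite xvar_fderiv_frac //; apply: vge_divsq => //.
have le : n + (word w g)%:Z *+ 2 <= (word w f)%:Z + (word w g)%:Z.
  by move: (word w f) (word w g) nfg => a b; rewrite mulr2n; lia.
apply: (vge_le le); rewrite tofracB (tofracM (xderiv i f)) (tofracM f).
apply: vgeB.
  exact: (vgeM (vge_xderiv i f) (vge_word w g)).
exact: vgeM (vge_word w f) (vge_xderiv i g).
Qed.

(* On weighted homogeneous polynomials of degree [d] the Euler operator is
   multiplication by [d]. *)
Lemma vge_euler x : vge 0 x -> vge 1 (\sum_i (w i)%:R * (xvar i * fderiv i x)).
Proof.
pose E f := \sum_i (w i)%:R * xderiv i f.
(* Subtracting the multiple by the weighted order cancels the part of lowest weight. *)
have EE f : vge (word w f).+1 (tofrac (E f - (word w f)%:R * f)).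
  apply: vge_tofrac => u; rewrite mcoeff_msupp mcoeffB raddf_sum /=.
  rewrite (eq_bigr (fun i => mcoeff u f *+ (w i * u i))); last first.
    move=> i _; rewrite mulr_natl mcoeffMn mcoeff_xderiv -mulrnA mulnC //.
  rewrite mulr_natl mcoeffMn sumrMnr -/(wdeg w u) => fu.
  have uf : u \in msupp f.
    by rewrite mcoeff_msupp; apply: contraNneq fu => ->; rewrite !mul0rn subrr.
  rewrite ltn_neqAle word_le // andbT; apply: contraNneq fu => ->.
  by rewrite subrr.
have [->|] := eqVneq x 0.
  by rewrite big1 ?vge0 // => i _; rewrite fderiv0 !mulr0.
have [f [g [g0 ->]]] := frac_num_den x.
rewrite mulf_eq0 invr_eq0 !tofrac_eq0 negb_or => /andP[f0 _].
have fg0 : tofrac f / tofrac g != 0.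
  by rewrite mulf_neq0 ?invr_eq0 ?tofrac_eq0.
rewrite vgeE // wval_frac // => vfg.
(* If [x] has positive order, every summand already has; otherwise numerator and denominator have
   the same order, and in the quotient rule the two multiples by it cancel. *)
have [lt|ge] := ltnP (word w g) (word w f).
  apply: vge_sum => i _; rewrite -[1]add0r; apply: vgeM.
    exact: (vge_int k w (w i)%:Z).
  apply: vge_xvar_fderiv; rewrite vgeE // wval_frac //.
  by move: (word w f) (word w g) lt => a b; lia.
have wfg : word w f = word w g.
  by apply/eqP; rewrite eqn_leq ge /=; move: vfg; rewrite subr_ge0 lez_nat.
rewrite (eq_bigr (fun i => (w i)%:R * (tofrac (xderiv i f * g -
   f * xderiv i g)) / tofrac g ^+ 2)); last first.
  by move=> i _; rewrite xvar_fderiv_frac // mulrA.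
rewrite -mulr_suml; apply: vge_divsq => //.
have -> : \sum_i (w i)%:R * tofrac (xderiv i f * g - f * xderiv i g) =
    tofrac ((E f - (word w f)%:R * f) * g - f * (E g - (word w g)%:R * g)).
  rewrite wfg (_ : _ - _ = E f * g - f * E g); last by ring.
  rewrite /E mulr_suml mulr_sumr -sumrB rmorph_sum; apply: eq_bigr => i _.
  rewrite -(rmorph_nat (@tofrac A)) -tofracM; congr (tofrac _).
  by rewrite mulrBr !mulrA [f * _]mulrC.
rewrite mulr2n addrA tofracB (tofracM _ g) (tofracM f); apply: vgeB.
  by have := vgeM (EE f) (vge_word w g); rewrite wfg -add1n PoszD.
have := vgeM (vge_word w f) (EE g); rewrite wfg -add1n PoszD.
by rewrite addrCA addrA.
Qed.

Lemma wval_xvar i : wval w (xvar i) = (w i)%:Z.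
Proof.
rewrite wval_tofrac ?mpolyX_neq0 //; congr Posz.
have [u] := word_attained w (mpolyX_neq0 (mnm1 i)).
rewrite msuppX inE => /eqP ->.
move=> ->; rewrite /wdeg (bigD1 i) //= mnm1E eqxx muln1 big1 ?addn0 // => j ji.
by rewrite mnm1E eq_sym (negPf ji) muln0.
Qed.

Lemma wval_lmon m : wval w (lmon m) = \sum_i (w i)%:Z * m i.
Proof.
rewrite logmorph_lmon; last exact: wvalM.
apply: eq_bigr => i _.
by rewrite wval_xvar -mulrzl mulrC intz.
Qed.

End WeightedOrder.
End Derivations.

(** The Smith normal form of the column [w] exhibits it as a multiple [e] of a column of a
    unimodular matrix; [e] divides every weight, so primitivity gives e = 1 or -1. *)
Lemma unimodular_completion N (w : 'I_N -> nat) (i0 : 'I_N) : primitive w ->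
  exists M L : 'M[int]_N, [/\ L *m M = 1%:M, M *m L = 1%:M,
    forall j, L j i0 = (w j)%:Z &
    forall i, \sum_j (w j)%:Z * M i j = (i == i0)%:Z].
Proof.
move=> wprim.
have [L Lu [R Ru [d _ wE]]] :=
  int_Smith_normal_form (\col_(j < N) (w j)%:Z).
pose i1 : 'I_N := Ordinal (leq_ltn_trans (leq0n i0) (ltn_ord i0)).
pose e := d`_0 * R 0 0.
have we j : (w j)%:Z = L j i1 * e.
  have := congr1 (fun A : 'cV_N => A j 0) wE; rewrite /e !mxE => ->.
  rewrite big_ord1 !mxE (bigD1 i1) //= big1 ?addr0 => [|i ni1].
    by rewrite !mxE eqxx mulr1n mulrA.
  rewrite !mxE; case: eqVneq => [i_0|]; last by rewrite mulr0n mulr0.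
  by case/eqP: ni1; apply: val_inj.
have e1 : `|e|%N = 1%N.
  apply: wprim => j; have := congr1 absz (we j); rewrite abszM /= => ->.
  exact: dvdn_mull.
have ee : e * e = 1 by nia.
(* The sign is absorbed and the column equal to [w] is moved to position [i0]. *)
pose L' := e *: xcol i0 i1 L.
have L'u : L' \in unitmx.
  have eu : e \is a GRing.unit by apply/unitrPr; exists e.
  rewrite unitmxE detZ unitrM unitrX // xcolE det_mulmx det_perm unitrM.
  by rewrite -unitmxE Lu unitrX ?unitrN1.
have L'w j : L' j i0 = (w j)%:Z by rewrite !mxE tpermL we mulrC.
exists (invmx L'), L'; split=> // [||i].
- exact: mulmxV.
- exact: mulVmx.
transitivity ((invmx L' *m L') i i0); last first.
  by rewrite mulVmx // mxE; case: eqP.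
by rewrite mxE; apply: eq_bigr => j _; rewrite L'w mulrC.
Qed.

Lemma divf_mulKC (F : fieldType) (a b c d : F) :
  a != 0 -> a^-1 * b * (c / d * a) = d^-1 * (c * b).
Proof.
move=> a0; rewrite [c / d * a]mulrC mulrACA mulVf // mul1r mulrA [b * c]mulrC.
exact: mulrC.
Qed.

(** * The discrepancy of a divisor with monomial valuation *)

Section ToricDiscrepancy.
Variables (k : fieldType) (N : nat) (w : 'I_N -> nat).
Local Notation K := (funField k N).
Local Notation vge := (vge w).
Implicit Types (x : K) (y : 'I_N -> K).

Lemma vge_det n (C : 'M[K]_n) : (forall i j, vge 0 (C i j)) -> vge 0 (\det C).
Proof.
move=> C0; apply: vge_sum => s _; rewrite -[0]addr0; apply: vgeM.
  by case: (odd_perm s); [exact: (vge_int k w (-1)) | exact: vge1].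
by apply: vge_prod => i _; exact: C0.
Qed.

Variable E : prime_divisor k N.
Hypothesis E_val : forall x, x != 0 -> div_val E x = wval w x.

Lemma local_ring0 : local_ring E 0.
Proof.
have [[[I_sub I0 _ _] I1 _] _ _] := div_ideal_height1 E.
exists 0, 1; split.
- exact: I_sub I0.
- by rewrite -tofrac1; exact: div_chart_poly.
- exact: I1.
- by rewrite mul0r.
Qed.

Lemma local_ringE x : local_ring E x <-> vge 0 x.
Proof.
have [->|x0] := eqVneq x 0.
  by split=> _; [exact: vge0 | exact: local_ring0].
have [_ _ _ /(_ x x0) O_val] := div_valP E.
by rewrite (vgeE _ _ x0) -(E_val x0).
Qed.

Lemma jacobian_transition y y' :
  is_differential_basis E y -> is_differential_basis E y' ->
  exists2 C, vge 0 (\det C) & jacobian y' = C *m jacobian y.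
Proof.
move=> [_ ybasis] [y'O _].
have [C CP] := choice (fun i => (fun h => let: ex_intro2 c c1 c2 := h in
  ex_intro (fun c => _ /\ _) c (conj c1 c2)) (ybasis _ (y'O i))).
exists (\matrix_(i, j) C i j).
  apply: vge_det => i j; rewrite mxE; apply/local_ringE.
  exact: (proj1 (CP i)).
apply/matrixP => i j; rewrite !mxE (proj2 (CP i)).
by apply: eq_bigr => l _; rewrite !mxE.
Qed.

(** The transition matrices in both directions have determinants of nonnegative order, so the two
    Jacobian determinants have equal order. Hence the value chosen in [discrepancy] can be computed
    in any one basis. *)
Lemma is_discrepancy_unique y n :
  is_differential_basis E y -> \det (jacobian y) != 0 ->
  is_discrepancy E n -> n = - wval w (\det (jacobian y)).
Proof.
move=> yb J0 [y' y'b ->]; congr (- _).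
have [C C0 J'E] := jacobian_transition yb y'b.
have [C' C'0 JE] := jacobian_transition y'b yb.
have JE' := congr1 determinant JE; have J'E' := congr1 determinant J'E.
rewrite det_mulmx in JE'; rewrite det_mulmx in J'E'.
have /andP[C'n J'n] : (\det C' != 0) && (\det (jacobian y') != 0).
  by rewrite -negb_or -mulf_eq0 -JE'.
have Cn : \det C != 0.
  by apply: contraNneq J'n => C00; rewrite J'E' C00 mul0r.
rewrite (vgeE _ _ Cn) in C0; rewrite (vgeE _ _ C'n) in C'0.
rewrite (E_val J'n); have e1 := congr1 (wval w) JE'.
have e2 := congr1 (wval w) J'E'.
rewrite (wvalM w C'n J'n) in e1; rewrite (wvalM w Cn J0) in e2.
move: (wval w (\det C)) (wval w (\det C')) C0 C'0 e1 e2.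
move: (wval w (\det (jacobian y))) (wval w (\det (jacobian y'))).
by move=> a b c d; lia.
Qed.

Variable i0 : 'I_N.
Hypothesis w_prim : primitive w.

(* The differential basis consists of the Laurent monomials whose exponents are
   the rows of a unimodular matrix [M] with [M w] a basis vector: the one of
   weight 1 is a uniformizer and the others are units. *)
Lemma toric_discrepancy : discrepancy E = (wsum w)%:Z - 1.
Proof.
have [M [L [LM ML Lw Mw]]] := unimodular_completion i0 w_prim.
pose y i := lmon k (fun j => M i j).
have y0 i : y i != 0 by exact: lmon_neq0.
have wy i : wval w (y i) = (i == i0)%:Z by rewrite wval_lmon Mw.
have yO i : vge 0 (y i) by rewrite (vgeE _ _ (y0 i)) wy.
have ybasis : is_differential_basis E y.
  split=> [i|x /local_ringE xO]; first exact/local_ringE.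
  (* These derivations are dual to the forms dy_i / y_i, as [L] is inverse to [M]; thus dx is the
     sum of the D_i(x) dy_i / y_i. *)
  pose D i := \sum_l (L l i)%:~R * (xvar k l * fderiv l x).
  exists (fun i => (y i)^-1 * D i) => [i|j]; last first.
    rewrite (eq_bigr (fun i => \sum_l (xvar k j)^-1 *
      ((L l i * M i j)%:~R * (xvar k l * fderiv l x)))) => [|i _]; last first.
      rewrite fderiv_lmon (divf_mulKC _ _ _ (y0 i)) !mulr_sumr.
      apply: eq_bigr => l _.
      congr (_ * _); rewrite intrM -mulrA; exact: mulrCA.
    rewrite exchange_big (bigD1 j) //= [X in _ + X]big1 ?addr0 => [|l lj].
      rewrite -mulr_sumr -mulr_suml -rmorph_sum /=.
      have := congr1 (fun A : 'M_N => A j j) LM; rewrite !mxE eqxx => ->.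
      by rewrite mul1r mulrA mulVf ?mul1r ?xvar_neq0.
    rewrite -mulr_sumr -mulr_suml -rmorph_sum /=.
    have := congr1 (fun A : 'M_N => A l j) LM; rewrite !mxE (negPf lj) => ->.
    by rewrite mul0r mulr0.
  apply/local_ringE.
  have yV : vge (- (i == i0)%:Z) (y i)^-1.
    by rewrite (vgeE _ _ (invr_neq0 (y0 i))) (wvalV _ (y0 i)) wy.
  rewrite -[0](addNr (i == i0)%:Z); apply: (vgeM yV).
  (* At [i0] the column of [L] is [w] and D is the Euler operator; the order it gains pays for
     dividing by the uniformizer. *)
  case: eqVneq => [->|_].
    rewrite /D (eq_bigr (fun l => (w l)%:R * (xvar k l * fderiv l x))).
      exact: vge_euler xO.
    by move=> l _; rewrite Lw.
  apply: vge_sum => l _; rewrite -[0%:Z]addr0; apply: vgeM.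
    exact: vge_int.
  exact: vge_xvar_fderiv xO.
have JE : jacobian y = diag_mx (\row_i y i) *m map_mx intr M *m
    diag_mx (\row_j (xvar k j)^-1).
  apply/matrixP => i j; rewrite mul_mx_diag mul_diag_mx !mxE fderiv_lmon.
  by rewrite mulrC mulrA.
have detM : \det M * \det L = 1 by rewrite -det_mulmx ML det1.
have detJ : \det (jacobian y) =
    \prod_i y i * (\det M)%:~R * \prod_j (xvar k j)^-1.
  rewrite JE !det_mulmx !det_diag det_map_mx; congr (_ * _ * _).
    by apply: eq_bigr => i _; rewrite mxE.
  by apply: eq_bigr => i _; rewrite mxE.
have dMn : (\det M)%:~R != 0 :> K.
  apply: contra_eq_neq (congr1 (fun z : int => z%:~R : K) detM) => e.
  by rewrite intrM e mul0r eq_sym oner_neq0.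
have dLn : (\det L)%:~R != 0 :> K.
  apply: contra_eq_neq (congr1 (fun z : int => z%:~R : K) detM) => e.
  by rewrite intrM e mulr0 eq_sym oner_neq0.
(* The integers det M and det L are inverse to each other, and both have nonnegative order. *)
have wdM : wval w ((\det M)%:~R : K) = 0.
  have := vge_int k w (\det M); have := vge_int k w (\det L).
  rewrite (vgeE _ _ dMn) (vgeE _ _ dLn).
  have := wvalM w dMn dLn; rewrite -intrM detM wval1.
  by move: (wval w _) (wval w _) => a b; lia.
have prod_neq0 (z : 'I_N -> K) : (forall i, z i != 0) -> \prod_i z i != 0.
  by move=> zn; apply/prodf_neq0 => i _; exact: zn.
have xVn (j : 'I_N) : (xvar k j)^-1 != 0 by exact: (invr_neq0 (xvar_neq0 k j)).
have yn : \prod_i y i != 0 := prod_neq0 _ y0.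
have xn : \prod_j (xvar k j)^-1 != 0 := prod_neq0 _ xVn.
have Jn : \det (jacobian y) != 0.
  rewrite detJ.
  exact (mulf_neq0 (mulf_neq0 yn dMn) xn).
have wJ : wval w (\det (jacobian y)) = 1 - (wsum w)%:Z.
  rewrite detJ (wvalM w (mulf_neq0 yn dMn) xn) (wvalM w yn dMn) wdM addr0.
  rewrite (logmorph_prod (@wvalM _ _ w) _ y0).
  rewrite (logmorph_prod (@wvalM _ _ w) _ xVn).
  congr (_ + _).
    rewrite (bigD1 i0) //= wy eqxx big1 ?addr0 // => i ni.
    by rewrite wy (negPf ni).
  rewrite (eq_bigr (fun i => - (w i)%:Z)) => [|i _]; last first.
    by rewrite (wvalV _ (xvar_neq0 k i)) wval_xvar.
  by rewrite sumrN /wsum (big_morph Posz PoszD (erefl _)).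
have nE : (wsum w)%:Z - 1 = - wval w (\det (jacobian y)).
  by rewrite wJ opprB.
rewrite nE; apply: xget_unique => [|n]; last exact: is_discrepancy_unique.
by exists y => //; rewrite (E_val Jn).
Qed.

End ToricDiscrepancy.

(** * Toric prime divisors *)

Section LaurentPolynomials.
Variables (k : fieldType) (N : nat).
Local Notation A := (mpoly N k).
Local Notation K := (funField k N).
Implicit Types (f g : A) (x y : K) (u v : multinom N) (m : 'I_N -> int).

Definition laurent x := exists f u, x = tofrac f / tofrac (mpolyX k u).

Lemma tofracX_neq0 u : tofrac (mpolyX k u) != 0.
Proof. by rewrite tofrac_eq0 mpolyX_neq0. Qed.

Lemma laurent_tofrac f : laurent (tofrac f).
Proof. by exists f, mnm0; rewrite mpolyX0 tofrac1 divr1. Qed.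

Lemma laurentD x y : laurent x -> laurent y -> laurent (x + y).
Proof.
move=> [f [u ->]] [g [v ->]].
exists (f * mpolyX k v + g * mpolyX k u), (mnm_add u v).
rewrite addf_div ?tofracX_neq0 // mpolyXD tofracD (tofracM f) (tofracM g).
by rewrite (tofracM (mpolyX k u)).
Qed.

Lemma laurentM x y : laurent x -> laurent y -> laurent (x * y).
Proof.
move=> [f [u ->]] [g [v ->]]; exists (f * g), (mnm_add u v).
by rewrite mulrACA -invfM mpolyXD (tofracM f) (tofracM (mpolyX k u)).
Qed.

Lemma laurent_lmon m : laurent (lmon k m).
Proof.
pose u : multinom N := Multinom [tuple `|Order.max (m i) 0|%N | i < N].
pose v : multinom N := Multinom [tuple `|Order.max (- m i) 0|%N | i < N].
exists (mpolyX k u), v; rewrite -!lmon_nat -lmonN -lmonD.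
by apply: eq_bigr => i _; congr (_ ^ _); rewrite !mnmE; lia.
Qed.

(** A monomial [s] clearing the denominators of all coefficients of the equation also clears the
    denominator of its root. *)
Lemma laurent_integrally_closed x (q : {poly K}) :
  q \is monic -> (forall i, laurent q`_i) -> root q x -> laurent x.
Proof.
move=> qm qL qx; have [f /= fP] := choice qL; have [u uE] := choice fP.
pose s := \prod_(i < size q) mpolyX k (u i).
have [i|h sx] := cic_integral (@cic_mpoly k N) (s := s) qm qx.
  have [lt|le] := ltnP i (size q); last first.
    by rewrite nth_default // mulr0; exists 0; rewrite tofrac0.
  rewrite uE /s (bigD1 (Ordinal lt)) //= mulrC.
  set p := \prod_(_ < _ | _) _; exists (f i * p).
  by rewrite (tofracM _ p) mulrA divfK ?tofracX_neq0 // tofracM.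
have sE : s = mpolyX k (\big[(@mnm_add N)/mnm0]_(i < size q) u i).
  by rewrite /s (big_morph _ (mpolyXD k) (mpolyX0 _ k)).
exists h, (\big[(@mnm_add N)/mnm0]_(i < size q) u i).
by rewrite -sx sE mulrC mulKf ?tofracX_neq0.
Qed.

Lemma lmon_exp m (z : int) : lmon k m ^ z = lmon k (fun i => m i * z).
Proof.
rewrite /lmon (big_morph (fun x => x ^ z) (fun x y => expfzMl x y z)
  (exp1rz _ z)).
by apply: eq_bigr => i _; rewrite exprz_exp.
Qed.

Lemma lmon_sum (I : Type) (r : seq I) (M : I -> 'I_N -> int) :
  lmon k (fun j => \sum_(i <- r) M i j) = \prod_(i <- r) lmon k (M i).
Proof.
rewrite /lmon exchange_big; apply: eq_bigr => j _ /=.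
elim: r => [|i r IH]; first by rewrite !big_nil expr0z.
by rewrite !big_cons expfzDr ?xvar_neq0 // IH.
Qed.

End LaurentPolynomials.

Section SubalgebraGen.
Variables (k : fieldType) (N n : nat) (g : 'I_n -> funField k N).
Local Notation S := (subalgebra_gen g).

(** The constants are embedded by a composite of ring morphisms, the form to which lemmas on [mmap]
    apply. *)
Lemma subalgebra_genE x :
  S x <-> exists P : mpoly n k,
    x = mmap (@tofrac (mpoly N k) \o mpolyC N (R := k)) g P.
Proof. by []. Qed.

Lemma subalgebra_const c : S (tofrac (mpolyC N c)).
Proof. by apply/subalgebra_genE; exists (mpolyC n c); rewrite mmapC. Qed.

Lemma subalgebra_mem i : S (g i).
Proof.
by apply/subalgebra_genE; exists (@mpolyX _ _ (mnm1 i)); rewrite mmapX mmap1U.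
Qed.

Lemma subalgebraD x y : S x -> S y -> S (x + y).
Proof.
move=> /subalgebra_genE[P ->] /subalgebra_genE[Q ->]; apply/subalgebra_genE.
by exists (P + Q); rewrite raddfD.
Qed.

Lemma subalgebraM x y : S x -> S y -> S (x * y).
Proof.
move=> /subalgebra_genE[P ->] /subalgebra_genE[Q ->]; apply/subalgebra_genE.
by exists (P * Q); rewrite rmorphM.
Qed.

Lemma subalgebra1 : S 1.
Proof. by rewrite -tofrac1 -(mpolyC1 N k); exact: subalgebra_const. Qed.

Lemma subalgebra0 : S 0.
Proof. by rewrite -tofrac0 -(mpolyC0 N k); exact: subalgebra_const. Qed.

Lemma subalgebraX x m : S x -> S (x ^+ m).
Proof.
move=> Sx; elim: m => [|m IH]; first by rewrite expr0; exact: subalgebra1.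
by rewrite exprS; exact: subalgebraM.
Qed.

End SubalgebraGen.

Lemma mdeg_gt0_ex N (u : multinom N) : (0 < mdeg u)%N -> exists i, u i != 0%N.
Proof.
move=> u0; apply/existsP; apply: contraLR u0; rewrite negb_exists.
move=> /forallP u0; rewrite -leqNgt leqn0 mdegE sum_nat_eq0.
by apply/forallP => i; have := u0 i; rewrite negbK.
Qed.

Lemma origin_ideal_coef0 (k : fieldType) N (f : mpoly N k) :
  mcoeff mnm0 f = 0 -> origin_ideal k N f.
Proof.
move=> f0 I [_ I0 ID IM] IX; rewrite [f]mpolyE big_seq.
apply: (big_ind I) => // u; rewrite mcoeff_msupp => fu.
have [i ui] : exists i, u i != 0%N.
  apply: mdeg_gt0_ex; rewrite lt0n mdeg_eq0; apply: contraNneq fu => ->.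
  by rewrite f0.
rewrite -mul_mpolyC -(submK (_ : lem (mnm1 i) u)) ?lep1mP // mpolyXD mulrA.
by apply: IM => //; apply: IX; exists i.
Qed.

(** * The prime divisor attached to a primitive weight *)

Section ToricDivisor.
Variables (k : fieldType) (N : nat) (w : 'I_N -> nat) (i0 : 'I_N).
Hypothesis w_prim : primitive w.
Local Notation A := (mpoly N k).
Local Notation K := (funField k N).
Local Notation vge := (vge w).
Implicit Types (f g : A) (x y : K) (u v : multinom N) (m : 'I_N -> int).

(* The chart of the toric variety whose fan is the single ray spanned by [w]. *)
Definition toric_chart : set K := [set x | laurent x /\ vge 0 x].
Definition toric_ideal : set K := [set x | laurent x /\ vge 1 x].

Lemma word_mpolyX u : word w (mpolyX k u) = wdeg w u.
Proof.
have [v] := word_attained w (mpolyX_neq0 k u).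
by rewrite msuppX inE => /eqP ->.
Qed.

Lemma vge_lmon n m : vge n (lmon k m) = (n <= \sum_i (w i)%:Z * m i).
Proof. by rewrite (vgeE _ _ (lmon_neq0 k m)) wval_lmon. Qed.

Lemma toric_chart_poly f : toric_chart (tofrac f).
Proof. by split; [exact: laurent_tofrac | exact: vge_poly]. Qed.

Lemma toric_chartD x y : toric_chart x -> toric_chart y -> toric_chart (x + y).
Proof.
by move=> [Lx vx] [Ly vy]; split; [exact: laurentD | exact: vgeD].
Qed.

Lemma toric_chartM x y : toric_chart x -> toric_chart y -> toric_chart (x * y).
Proof.
by move=> [Lx vx] [Ly vy]; split; [exact: laurentM | exact: vgeM vx vy].
Qed.

Lemma toric_chart_lmon m : 0 <= \sum_i (w i)%:Z * m i -> toric_chart (lmon k m).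
Proof. by move=> m0; split; [exact: laurent_lmon | rewrite vge_lmon]. Qed.

(** The order of a Laurent polynomial is the least weight of its monomials, so each monomial of an
    element of the chart lies in the chart. *)
Lemma toric_chart_monomials x : toric_chart x ->
  exists f u, x = \sum_(v <- msupp f) tofrac (mpolyC N (mcoeff v f)) *
      lmon k (fun i => (v i)%:Z - (u i)%:Z) /\
    forall v, v \in msupp f ->
      0 <= \sum_i (w i)%:Z * ((v i)%:Z - (u i)%:Z).
Proof.
move=> [[f [u xE]] vx]; exists f, u; split.
  rewrite xE {1}[f]mpolyE rmorph_sum mulr_suml; apply: eq_bigr => v _ /=.
  rewrite lmonD lmonN !lmon_nat -mul_mpolyC.
  by rewrite (tofracM (mpolyC N (mcoeff v f))) mulrA.
have [f0|f0] := eqVneq f 0; first by rewrite f0 msupp0.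
move=> v vf.
rewrite (eq_bigr (fun i => (w i)%:Z * v i - (w i)%:Z * u i)); last first.
  by move=> i _; rewrite mulrBr.
have x0 : x != 0.
  by rewrite xE mulf_neq0 ?invr_neq0 ?tofracX_neq0 ?tofrac_eq0.
have sumE v' : \sum_i (w i)%:Z * (v' i)%:Z = (wdeg w v')%:Z.
  by rewrite /wdeg (big_morph Posz PoszD (erefl _)); apply: eq_bigr => i _.
rewrite sumrB !sumE.
move: vx; rewrite (vgeE _ _ x0) xE (wval_frac _ f0 (mpolyX_neq0 k u)).
rewrite word_mpolyX => le; apply: le_trans le _.
by rewrite lerB // lez_nat word_le.
Qed.

(** In the coordinates y_i the monomials of the chart are those whose exponent at [i0] is
    nonnegative, so the y_i and the inverses of the others generate. *)
Lemma toric_chart_fg : exists n (g : 'I_n -> K), toric_chart = subalgebra_gen g.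
Proof.
have [M [L [LM ML Lw Mw]]] := unimodular_completion i0 w_prim.
(* The value 1 at [i0] is a filler that keeps the inverses indexed by ['I_N]. *)
pose y i := lmon k (M i); pose yinv i := if i == i0 then 1 else (y i)^-1.
pose g (j : 'I_(N + N)) := match fintype.split j with
  inl i => y i | inr i => yinv i end.
have gl i : g (lshift N i) = y i.
  by rewrite /g; case: split_ordP => j /eqP; rewrite ?eq_lshift ?eq_lrshift //
    => /eqP ->.
have gr i : g (rshift N i) = yinv i.
  by rewrite /g; case: split_ordP => j /eqP; rewrite ?eq_rshift ?eq_rlshift //
    => /eqP ->.
have yB i : toric_chart (y i).
  by apply: toric_chart_lmon; rewrite Mw; case: (i == i0).
have one : toric_chart 1 by rewrite -tofrac1; exact: toric_chart_poly.
have yinvB i : toric_chart (yinv i).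
  rewrite /yinv; case: eqVneq => [_|ni]; first exact: one.
  rewrite /y -lmonN; apply: toric_chart_lmon.
  rewrite (eq_bigr (fun j => - ((w j)%:Z * M i j))) => [|j _].
    by rewrite sumrN Mw (negPf ni).
  by rewrite mulrN.
have gB j : toric_chart (g j).
  by rewrite /g; case: fintype.split => i; [exact: yB | exact: yinvB].
exists (N + N)%N, g; apply/seteqP; split=> x; last first.
  move=> [P ->]; rewrite /mmap.
  apply: (big_ind toric_chart) => [||m _].
  - by rewrite -tofrac0; exact: toric_chart_poly.
  - exact: toric_chartD.
  apply: toric_chartM; first exact: toric_chart_poly.
  apply: (big_ind toric_chart) => [||i _]; first exact: one.
    exact: toric_chartM.
  elim: (m i) => [|n IH]; first by rewrite expr0; exact: one.
  by rewrite exprS; exact: toric_chartM.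
move=> /toric_chart_monomials[f [u [-> fu]]]; rewrite big_seq.
apply: (big_ind (subalgebra_gen g)) => [||v /fu {fu} v0].
- exact: subalgebra0.
- exact: subalgebraD.
apply: subalgebraM; first exact: subalgebra_const.
pose m i := (v i)%:Z - (u i)%:Z; rewrite -/m in v0 *.
(* The exponents of the monomial in the new coordinates: m = (m L) M. The one at [i0] is w.m, the
   order of the monomial. *)
pose e i := \sum_j m j * L j i.
have -> : lmon k m = \prod_i y i ^ e i.
  have -> : lmon k m = lmon k (fun j => \sum_i M i j * e i).
    apply: eq_bigr => j _; congr (_ ^ _).
    transitivity (\sum_l m l * (L *m M) l j).
      rewrite LM (bigD1 j) //= mxE eqxx mulr1 big1 ?addr0 // => l lj.
      by rewrite mxE (negPf lj) mulr0.
    under [RHS]eq_bigr => i _ do rewrite mulr_sumr.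
    rewrite exchange_big; apply: eq_bigr => l _ /=.
    rewrite mxE mulr_sumr; apply: eq_bigr => i _.
    by rewrite [RHS]mulrC mulrA.
  rewrite lmon_sum; apply: eq_bigr => i _.
  by rewrite /y lmon_exp.
apply: (big_ind (subalgebra_gen g)) => [||i _].
- exact: subalgebra1.
- exact: subalgebraM.
have yS : subalgebra_gen g (y i) by rewrite -gl; exact: subalgebra_mem.
case ei: (e i) => [n|n]; first exact: subalgebraX.
have ni : i != i0.
  apply: contra_eq_neq ei => ->; rewrite /e.
  rewrite (eq_bigr (fun j => (w j)%:Z * m j)) => [|j _]; last first.
    by rewrite Lw mulrC.
  by rewrite gt_eqF //; apply: lt_le_trans v0.
have -> : y i ^ Negz n = yinv i ^+ n.+1.
  by rewrite /yinv (negPf ni) exprVn.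
by apply: subalgebraX; rewrite -gr; exact: subalgebra_mem.
Qed.

(** Laurent polynomials are integrally closed. If [x] had negative order, the lower terms of its
    equation would have order at least (d - 1) v(x), which exceeds the order d v(x) of x^d. *)
Lemma toric_chart_normal : integrally_closed_in toric_chart.
Proof.
move=> x q qm qB qx; split.
  by apply: (laurent_integrally_closed qm _ qx) => i; case: (qB i).
have [->|x0] := eqVneq x 0; first exact: vge0.
have [d d0 xd] := monic_root_expansion qm qx.
have wX n : wval w (x ^+ n) = wval w x *+ n.
  exact: (logmorph_exprz (@wvalM _ _ w) n x0).
rewrite (vgeE _ _ x0) leNgt; apply/negP => x_lt0.
have : vge (wval w x *+ d.-1) (x ^+ d).
  rewrite xd vgeN; apply: vge_sum => i _.
  rewrite -[_ *+ _]add0r; apply: vgeM; first by case: (qB i).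
  rewrite (vgeE _ _ (expf_neq0 _ x0)) wX.
  have -> : d.-1 = (d.-1 - i + i)%N by have := ltn_ord i; lia.
  rewrite mulrnDr gerDr; apply: mulrn_wle0; exact: ltW.
rewrite (vgeE _ _ (expf_neq0 _ x0)) wX.
have -> : wval w x *+ d = wval w x + wval w x *+ d.-1.
  by rewrite -mulrS prednK.
by rewrite lerDr leNgt x_lt0.
Qed.

Lemma exists_uniformizer : exists m, \sum_i (w i)%:Z * m i = 1.
Proof.
have [M [_ [_ _ _ Mw]]] := unimodular_completion i0 w_prim.
by exists (M i0); rewrite Mw eqxx.
Qed.

(** A monomial [t] of order 1 is a unit among Laurent polynomials, so it generates the ideal. A
    nonzero element of a smaller prime [J] is a power of [t] times an element of order 0, which is
    outside [J]; hence [t] is in [J]. *)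
Lemma toric_ideal_height1 : is_height_one_prime toric_chart toric_ideal.
Proof.
have [m wm] := exists_uniformizer; pose t : K := lmon k m.
have t0 : t != 0 by exact: lmon_neq0.
have wt : wval w t = 1 by rewrite wval_lmon.
have tL : laurent t by exact: laurent_lmon.
have tVL : laurent t^-1 by rewrite -lmonN; exact: laurent_lmon.
have tP : toric_ideal t by split=> //; rewrite (vgeE _ _ t0) wt.
have sub : toric_ideal `<=` toric_chart.
  by move=> x [Lx vx]; split=> //; apply: vge_le vx.
split.
- split; first split.
  + exact: sub.
  + by split; [rewrite -tofrac0; exact: laurent_tofrac | exact: vge0].
  + by move=> x y [Lx vx] [Ly vy]; split; [exact: laurentD | exact: vgeD].
  + by move=> b x [Lb vb] [Lx vx]; split; [exact: laurentM | exact: vgeM vb vx].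
  + by move=> [_]; rewrite (vgeE _ _ (oner_neq0 _)) wval1.
  move=> x y [Lx vx] [Ly vy] [_ vxy].
  have [x0|x0] := eqVneq x 0; first by left; split; rewrite // x0; exact: vge0.
  have [y0|y0] := eqVneq y 0; first by right; split; rewrite // y0; exact: vge0.
  rewrite (vgeE _ _ x0) in vx; rewrite (vgeE _ _ y0) in vy.
  rewrite (vgeE _ _ (mulf_neq0 x0 y0)) (wvalM w x0 y0) in vxy.
  have [xP|yP] : 1 <= wval w x \/ 1 <= wval w y by lia.
    by left; split=> //; rewrite (vgeE _ _ x0).
  by right; split=> //; rewrite (vgeE _ _ y0).
- move=> P0; have : [set 0] t by rewrite -P0; exact: tP.
  by move=> t00; move: t0; rewrite t00 eqxx.
move=> J [[J_sub J0 JD JM] J1 Jprime] JP.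
have [Jz|/existsNP[x /not_implyP[Jx /eqP x0]]] :=
    pselect (forall x, J x -> x = 0).
  by left; apply/seteqP; split=> [x /Jz|x ->].
right; apply/seteqP; split=> [//|y [Ly vy]].
have [Lx vx] := JP x Jx; rewrite (vgeE _ _ x0) in vx.
have [n nE] : exists n, wval w x = n.+1%:Z by exists `|wval w x|.-1; lia.
have wtX i : wval w (t ^+ i) = i%:Z.
  by rewrite (logmorph_exprz (@wvalM _ _ w) i t0) wt intz.
have tB i : toric_chart (t ^+ i).
  elim: i => [|i IH].
    by rewrite expr0 -tofrac1; exact: toric_chart_poly.
  by rewrite exprS; apply: toric_chartM IH; exact: sub.
pose z := x / t ^+ n.+1.
have tn0 : t ^+ n.+1 != 0 := expf_neq0 _ t0.
have z0 : z != 0 := mulf_neq0 x0 (invr_neq0 tn0).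
have wz : wval w z = 0.
  by rewrite (wvalM w x0 (invr_neq0 tn0)) (wvalV w tn0) wtX nE subrr.
have zB : toric_chart z.
  split; last by rewrite (vgeE _ _ z0) wz.
  apply: laurentM => //; rewrite -exprVn.
  elim: (n.+1) => [|i IH].
    by rewrite expr0 -tofrac1; exact: laurent_tofrac.
  by rewrite exprS; exact: laurentM.
have zJ : ~ J z by move=> /JP[_]; rewrite (vgeE _ _ z0) wz.
have xE : z * t ^+ n.+1 = x := divfK tn0 x.
have [//|tJ] := Jprime z (t ^+ n.+1) zB (tB _) (eq_ind_r J Jx xE).
have {tJ} tJ : J t.
  elim: (n.+1) tJ => [|i IH]; first by rewrite expr0.
  rewrite exprS => /(Jprime _ _ (sub _ tP) (tB i)) [//|]; exact: IH.
rewrite -(divfK t0 y); apply: JM => //; split; first exact: laurentM.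
rewrite -[0](subrr 1); apply: vgeM vy _.
by rewrite (vgeE _ _ (invr_neq0 t0)) (wvalV w t0) wt.
Qed.

Lemma toric_valuation :
  is_valuation_of (localization toric_chart toric_ideal) (wval (k := k) w).
Proof.
have [m wm] := exists_uniformizer; pose t : K := lmon k m.
split=> [x y|x y||x x0].
- exact: wvalM.
- exact: wvalD.
- by exists t; [exact: lmon_neq0 | rewrite wval_lmon].
split=> [[a [s [[La va] [Ls vs] sP xE]]]|wx].
  have a0 : a != 0 by apply: contraNneq x0 => a0; rewrite xE a0 mul0r.
  have s0 : s != 0.
    by apply: contraNneq x0 => s0; rewrite xE s0 invr0 mulr0.
  have ws : wval w s = 0.
    apply/eqP; rewrite eq_le; rewrite (vgeE _ _ s0) in vs; rewrite vs andbT.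
    rewrite leNgt; apply/negP => ws; apply: sP; split=> //.
    by rewrite (vgeE _ _ s0).
  rewrite xE (wvalM w a0 (invr_neq0 s0)) (wvalV w s0) ws oppr0 addr0.
  by rewrite -(vgeE _ _ a0).
have [f [g [g0 xE]]] := frac_num_den x.
have f0 : f != 0.
  by apply: contraNneq x0 => f0; rewrite xE f0 tofrac0 mul0r.
(* A monomial of order minus that of [g]: multiplying by it turns [g] into a denominator of order 0,
   and numerator and denominator remain Laurent polynomials. *)
pose r := lmon k (fun i => m i * - (word w g)%:Z).
have r0 : r != 0 by exact: lmon_neq0.
have rL : laurent r by exact: laurent_lmon.
have wr : wval w r = - (word w g)%:Z.
  rewrite wval_lmon (eq_bigr (fun i => - (word w g)%:Z * ((w i)%:Z * m i))).
    by rewrite -mulr_sumr wm mulr1.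
  by move=> i _; rewrite mulrA mulrC.
have f0' : tofrac f != 0 by rewrite tofrac_eq0.
have g0' : tofrac g != 0 by rewrite tofrac_eq0.
rewrite xE (wval_frac _ f0 g0) in wx.
have wgr : wval w (tofrac g * r) = 0.
  by rewrite (wvalM w g0' r0) (wval_tofrac _ g0) wr subrr.
exists (tofrac f * r), (tofrac g * r); split.
- split; first exact: laurentM (laurent_tofrac f) rL.
  rewrite (vgeE _ _ (mulf_neq0 f0' r0)) (wvalM w f0' r0) (wval_tofrac _ f0).
  by rewrite wr.
- split; first exact: laurentM (laurent_tofrac g) rL.
  by rewrite (vgeE _ _ (mulf_neq0 g0' r0)) wgr.
- by move=> [_]; rewrite (vgeE _ _ (mulf_neq0 g0' r0)) wgr.
- by rewrite xE -mulf_div (divff r0) mulr1.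
Qed.

Definition toric_divisor : prime_divisor k N :=
  PrimeDivisor toric_chart_fg toric_chart_poly toric_chart_normal
    toric_ideal_height1 toric_valuation.

Lemma toric_divisor_center : center_contains_origin toric_divisor.
Proof.
move=> f [_ vf]; apply: origin_ideal_coef0; apply/eqP/negPn/negP => f00.
have f0 : f != 0 by apply: contraNneq f00 => ->; rewrite mcoeff0.
have f0' : tofrac f != 0 by rewrite tofrac_eq0.
rewrite (vgeE _ _ f0') (wval_tofrac _ f0) in vf.
have := @word_le _ _ w f mnm0; rewrite mcoeff_msupp => /(_ f00).
rewrite /wdeg big1 => [|i _]; last by rewrite mnm0E muln0.
by rewrite leqn0 => /eqP wf; rewrite wf in vf.
Qed.

End ToricDivisor.

(** * Ideals containing a power of the origin *)

Section ToricPrimeDivisors.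
Variables (k : fieldType) (N : nat).
Implicit Types (E : prime_divisor k N) (w : 'I_N -> nat).

Lemma toric_wval E : is_toric E ->
  exists w, forall x, x != 0 -> div_val E x = wval w x.
Proof.
move=> [w Ew]; exists w.
have Epoly f : f != 0 -> div_val E (tofrac f) = (word w f)%:Z.
  move=> f0; have [[u uf uE] le] := Ew f f0.
  have [v vf ve] := word_attained w f0.
  apply/eqP; rewrite eq_le; apply/andP; split.
    by rewrite ve; exact: le vf.
  by rewrite uE lez_nat; exact: word_le uf.
move=> x x0; have [f [g [g0 xE]]] := frac_num_den x.
have f0 : f != 0.
  by apply: contraNneq x0 => f0; rewrite xE f0 tofrac0 mul0r.
have g0' : tofrac g != 0 by rewrite tofrac_eq0.
have [vM _ _ _] := div_valP E.
have := vM x (tofrac g) x0 g0'; rewrite {1}xE (divfK g0' (tofrac f)).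
rewrite (Epoly f f0) (Epoly g g0) {3}xE (wval_frac w f0 g0).
by move: (div_val E x) (word w f) (word w g) => a b c; lia.
Qed.

(** A common divisor of the weights divides every value of the valuation, and a normalized valuation
    takes the value 1. *)
Lemma toric_primitive E w : (forall x, x != 0 -> div_val E x = wval w x) ->
  primitive w.
Proof.
move=> Ew d dw; have [_ _ [t t0 vt] _] := div_valP E.
have dword f : f != 0 -> (d %| word w f)%N.
  move=> f0; have [u _ ->] := word_attained w f0; rewrite /wdeg.
  apply: (big_ind (fun n => d %| n)%N) => [||i _]; first exact: dvdn0.
    exact: dvdn_add.
  by rewrite dvdn_mulr.
rewrite (Ew t t0) in vt; have [f [g [g0 tE]]] := frac_num_den t.
have f0 : f != 0.
  by apply: contraNneq t0 => f0; rewrite tE f0 tofrac0 mul0r.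
rewrite tE (wval_frac w f0 g0) in vt.
have fE : word w f = (word w g + 1)%N.
  by move: (word w f) (word w g) vt => a b; lia.
apply/eqP; rewrite -dvdn1 -(@dvdn_addr (word w g)) ?dword //.
by rewrite -fE dword.
Qed.

Lemma primitive_wsum_gt0 w : primitive w -> (0 < wsum w)%N.
Proof.
move=> wp; rewrite lt0n; apply/eqP => w0.
(* For w = 0 the number 2 would be a common divisor of the weights. *)
suff : 2 = 1 :> nat by [].
apply: wp => i; move/eqP: w0; rewrite sum_nat_eq0.
by move=> /forallP/(_ i)/implyP/(_ isT)/eqP ->.
Qed.

End ToricPrimeDivisors.

Section BoundedExponents.
Variables (k : fieldType) (N mu : nat) (i0 : 'I_N) (a : set (mpoly N k)).
Hypothesis mu_a : ideal_pow (origin_ideal k N) mu `<=` a.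
Implicit Types (u v : multinom N).

Lemma mpolyX_prod_origin n u : mdeg u = n -> exists2 f : 'I_n -> mpoly N k,
  (forall i, origin_ideal k N (f i)) & mpolyX k u = \prod_i f i.
Proof.
elim: n u => [|n IH] u un.
  exists (fun=> 0) => [[]//|].
  by move/eqP: un; rewrite mdeg_eq0 => /eqP ->; rewrite mpolyX0 big_ord0.
have [i ui] : exists i, u i != 0%N by apply: mdeg_gt0_ex; rewrite un.
have uE : mnm_add (mnm_sub u (mnm1 i)) (mnm1 i) = u by rewrite submK // lep1mP.
have [f fO fE] : exists2 f : 'I_n -> mpoly N k,
    (forall i, origin_ideal k N (f i)) &
    mpolyX k (mnm_sub u (mnm1 i)) = \prod_i f i.
  by apply: IH; move: un; rewrite -{1}uE mdegD mdeg1 addn1 => -[].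
exists (fun j => if unlift ord0 j is Some j' then f j' else mpolyX k (mnm1 i)).
  move=> j; case: unliftP => [j' _|_]; first exact: fO.
  by move=> I _; apply; exists i.
rewrite big_ord_recl unlift_none.
under eq_bigr => j _ do rewrite liftK.
by rewrite -fE -mpolyXD addmC uE.
Qed.

Lemma mpolyX_mem_ideal u : mdeg u = mu -> a (mpolyX k u).
Proof.
move=> um; apply: mu_a; have [f fO ->] := mpolyX_prod_origin um.
by move=> I _; apply; exists f.
Qed.

Lemma exists_sub_multinom u n : (n <= mdeg u)%N ->
  exists2 v, lem v u & mdeg v = n.
Proof.
move=> /subnK; move: (mdeg u - n)%N => d; elim: d u => [|d IH] u du.
  by exists u => //; rewrite lepm_refl.
have [i ui] : exists i, u i != 0%N by apply: mdeg_gt0_ex; rewrite -du.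
have uE : mnm_add (mnm_sub u (mnm1 i)) (mnm1 i) = u by rewrite submK // lep1mP.
have [|v vu vn] := IH (mnm_sub u (mnm1 i)).
  by move: du; rewrite -{1}uE mdegD mdeg1 addn1 addSn => -[].
by exists v => //; apply: lepm_trans vu (lem_subr _ _).
Qed.

(* The weighted orders of [a] only depend on these finitely many exponents. *)
Definition bounded_exponents : {set bmultinom N mu.+1} :=
  [set u : bmultinom N mu.+1 | `[< exists2 f, a f & bmnm u \in msupp f >]].

Definition exponent_seq (T : {set bmultinom N mu.+1}) : seq (multinom N) :=
  map (@bmnm N mu.+1) (enum T).

Lemma exponent_seqP (u : multinom N) : reflect
  ((mdeg u <= mu)%N /\ exists2 f, a f & u \in msupp f)
  (u \in exponent_seq bounded_exponents).
Proof.
apply: (iffP mapP) => [[v]|[um [f af uf]]].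
  rewrite mem_enum inE => /asboolP vf ->; split=> //.
  by have := bmdeg v; rewrite ltnS.
exists (BMultinom (um : (mdeg u < mu.+1)%N)) => //.
by rewrite mem_enum inE; apply/asboolP; exists f.
Qed.

Lemma exponent_seq_neq0 : exists u, u \in exponent_seq bounded_exponents.
Proof.
have um : mdeg (mnm_muln (mnm1 i0) mu) = mu by rewrite mdegMn mdeg1 mul1n.
exists (mnm_muln (mnm1 i0) mu); apply/exponent_seqP; split; first by rewrite um.
by exists (mpolyX k (mnm_muln (mnm1 i0) mu)); rewrite ?msuppX ?inE //;
  exact: mpolyX_mem_ideal.
Qed.

Lemma wdeg_mono (w : 'I_N -> nat) u v : lem u v -> (wdeg w u <= wdeg w v)%N.
Proof. by move=> /mnm_lepP uv; apply: leq_sum => i _; rewrite leq_mul. Qed.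

(** An exponent of degree above [mu] has a subexponent of degree [mu], whose monomial lies in [a]
    and whose weight is no larger because the weights are nonnegative. *)
Lemma ideal_val_exponents (E : prime_divisor k N) (w : 'I_N -> nat) :
  (forall x, x != 0 -> div_val E x = wval w x) ->
  exists n : nat, [/\ ideal_val E a = n%:Z,
    forall u, u \in exponent_seq bounded_exponents -> (n <= wdeg w u)%N &
    exists2 u, u \in exponent_seq bounded_exponents & n = wdeg w u].
Proof.
move=> Ew; have [u1 u1S] := exponent_seq_neq0.
have [u0 u0S u0min] : exists2 u, u \in exponent_seq bounded_exponents &
    forall v, v \in exponent_seq bounded_exponents -> (wdeg w u <= wdeg w v)%N.
  (* Maximising 1 / (w.u + 1) minimises w.u; the successor keeps the denominators positive. *)
  have [u uS umax] := @exists_max_ratio _ (fun=> 1%N) (fun u => (wdeg w u).+1)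
    u1 _ u1S (fun _ _ => isT).
  by exists u => // v /umax; rewrite !mul1n ltnS.
exists (wdeg w u0); split=> //; last by exists u0.
have [_ [f0 af0 u0f0]] := exponent_seqP _ u0S.
have f00 : f0 != 0 by apply: contraTneq u0f0 => ->; rewrite msupp0.
have tofrac_val f : f != 0 -> div_val E (tofrac f) = (word w f)%:Z.
  by move=> fn; rewrite Ew ?tofrac_eq0 // wval_tofrac.
have lower f : a f -> f != 0 -> (wdeg w u0 <= word w f)%N.
  move=> af fn; have [u uf ->] := word_attained w fn.
  have [um|um] := leqP (mdeg u) mu.
    by apply: u0min; apply/exponent_seqP; split=> //; exists f.
  have [v vu vm] := exists_sub_multinom (ltnW um).
  apply: leq_trans (wdeg_mono w vu); apply: u0min; apply/exponent_seqP.
  split; first by rewrite vm.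
  by exists (mpolyX k v); [exact: mpolyX_mem_ideal | rewrite msuppX inE].
have f0val : div_val E (tofrac f0) = (wdeg w u0)%:Z.
  rewrite (tofrac_val f0 f00); congr Posz; apply/eqP.
  by rewrite eqn_leq (word_le w u0f0) lower.
apply: xget_unique => [|n [[f [af fn <-]] nmin]].
  split; first by exists f0.
  by move=> f af fn; rewrite (tofrac_val f fn) lez_nat lower.
apply/eqP; rewrite eq_le -{1}f0val (nmin f0 af0 f00).
by rewrite (tofrac_val f fn) lez_nat lower.
Qed.

Section Lct.
Variable R : realType.
Local Open Scope ereal_scope.

Lemma toric_lct_ratio (E : prime_divisor k N) (w : 'I_N -> nat) :
  (forall x, (x != 0)%R -> div_val E x = wval w x) ->
  exists n : nat, [/\ lct_ratio R E a =
      (if n == 0%N then +oo else ((wsum w)%:R / n%:R)%R%:E),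
    forall u, u \in exponent_seq bounded_exponents -> (n <= wdeg w u)%N &
    exists2 u, u \in exponent_seq bounded_exponents & n = wdeg w u].
Proof.
move=> Ew; have [n [nE nle nat]] := ideal_val_exponents Ew.
exists n; split=> //; rewrite /lct_ratio nE eqz_nat.
by rewrite (toric_discrepancy Ew i0 (toric_primitive Ew)) subrK.
Qed.

(** The center of [E0] bounds the threshold above by its ratio. Conversely the approximating
    divisors have at least this ratio, and theirs is below the threshold plus [e]. *)
Lemma toric_lct_eq (E0 : prime_divisor k N) :
  has_toric_approximation R a -> center_contains_origin E0 ->
  (forall E, is_toric E -> lct_ratio R E0 a <= lct_ratio R E a) ->
  lct_ratio R E0 a = lct R a.
Proof.
move=> approx E0c E0min; apply/eqP; rewrite eq_le.
apply/andP; split; last first.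
  by apply: ereal_inf_lbound; exists E0.
have ratio_ninf (E : prime_divisor k N) : lct_ratio R E a != -oo.
  by rewrite /lct_ratio; case: ifP.
case lctE: (lct R a) => [r||]; last 2 first.
- by rewrite leey.
(* A threshold -oo would be at infinite distance from every ratio. *)
- have [E _] := approx 1%R ltr01; rewrite lctE.
  by move: (ratio_ninf E); case: (lct_ratio R E a).
apply/lee_addgt0Pr => e e0; have [E /E0min le] := approx e e0.
move=> h; apply: (le_trans le); rewrite lctE in h.
move: (ratio_ninf E) h; case: (lct_ratio R E a) => [x _||] //.
rewrite -EFinB abse_EFin lte_fin -EFinD lee_fin => /ltW.
by rewrite ler_distl => /andP[].
Qed.

End Lct.
End BoundedExponents.

Theorem theorem1p11 (N mu : nat) (hN : (0 < N)%N) (hmu : (0 < mu)%N) :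
  exists L : nat, (0 < L)%N /\
    forall (R : realType) (k : closedFieldType) (p : nat)
           (hp : p \in [pchar k]) (a : set (polyRing k N)),
      primary_to (origin_ideal k N) a ->
      ideal_pow (origin_ideal k N) mu `<=` a ->
      has_toric_approximation R a ->
      exists E : prime_divisor k N,
        computes_lct R E a /\ discrepancy E <= L%:Z.
Proof.
pose optimal (T : {set bmultinom N mu.+1}) w := primitive w /\ exists t,
  (forall u, u \in exponent_seq T -> (t <= wdeg w u)%N) /\
  forall v s, (0 < wsum v)%N ->
    (forall u, u \in exponent_seq T -> (s <= wdeg v u)%N) ->
    (s * wsum w <= t * wsum v)%N.
(* The weights are chosen for all sets [T] before any field or ideal is given; an empty [T] gets the
   zero weight as a default. *)
have Wex (T : {set bmultinom N mu.+1}) :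
    exists w, (exists u, u \in exponent_seq T) -> optimal T w.
  have [[u uT]|nT] := pselect (exists u, u \in exponent_seq T).
    have [w [t [w0 wp wT wmax]]] := exists_optimal_weight hN uT.
    by exists w => _; split=> //; exists t.
  by exists (fun=> 0%N) => /nT.
have [W WP] := choice Wex.
(* The successor only ensures that the bound is positive. *)
exists (\max_T wsum (W T)).+1; split=> // R k p hp a _ mu_a approx.
pose i0 := Ordinal hN; pose T := bounded_exponents mu a.
have [wp [t [wT wmax]]] := WP T (exponent_seq_neq0 i0 mu_a).
pose w := W T; pose E0 := toric_divisor k i0 wp.
have E0w x : x != 0 -> div_val E0 x = wval w x by [].
have w0 : (0 < wsum w)%N := primitive_wsum_gt0 wp.
exists E0; split; last first.
  rewrite (toric_discrepancy E0w i0 wp).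
  have le : (wsum w <= \max_T wsum (W T))%N by exact: leq_bigmax.
  by move: (wsum w) (\max_T wsum (W T)) le => b c; lia.
split; first exact: toric_divisor_center.
apply: toric_lct_eq approx _ _; first exact: toric_divisor_center.
move=> E /toric_wval[v Ev].
have [n [-> _ [u uT nu]]] := toric_lct_ratio i0 mu_a R E0w.
have [m [-> mT _]] := toric_lct_ratio i0 mu_a R Ev.
have v0 : (0 < wsum v)%N := primitive_wsum_gt0 (toric_primitive Ev).
have tn : (t <= n)%N by rewrite nu; exact: wT.
(* With [n] and [m] the values of [a] along [E0] and [E], this is m |w| <= t |v| <= n |v|, the
   comparison of ratios after cross multiplication; it also gives n > 0 when m > 0. *)
have le := leq_trans (wmax v m v0 mT) (leq_mul tn (leqnn (wsum v))).
have [_|m0] := posnP m; first by rewrite leey.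
have n0 : (0 < n)%N.
  rewrite lt0n; apply: contraTneq le => ->.
  by rewrite mul0n -ltnNge muln_gt0 m0.
rewrite (gtn_eqF n0) lee_fin.
rewrite ler_pdivrMr ?ltr0n // mulrAC ler_pdivlMr ?ltr0n // -!natrM ler_nat.
by rewrite mulnC [X in (_ <= X)%N]mulnC.
Qed.
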